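(* Let $k=ab$ where $a,b$ are primes with $a\equiv b\equiv1\pmod4$, and let $m$ be a nonzero integer. For the existence of integers $x,y,z$ with $x^2+y^2+z^k=m$ it is necessary, and under Schinzel's hypothesis (H) also sufficient, that both of the following hold: (1) there is no integer $n\equiv6\pmod8$ such that $m=n^a$ and such that for each prime $p\equiv3\pmod4$ dividing $n$: $b\nmid v_p(n)$ or $2\mid v_p(n)$ or there is no $z'\in\{0,\dots,p-1\}$ with $p\mid \sum_{i=0}^{a-1}r_p(n)^{a-1-i}z'^{ib}$; (2) there is no integer $n\equiv6\pmod8$ such that $m=n^b$ and such that for each prime $p\equiv3\pmod4$ dividing $n$: $a\nmid v_p(n)$ or $2\mid v_p(n)$ or there is no $z'\in\{0,\dots,p-1\}$ with $p\mid \sum_{i=0}^{b-1}r_p(n)^{b-1-i}z'^{ia}$.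
   Context: For a prime $p$ and $x\in\mathbb{Q}_p^\times$, $r_p(x)=x/p^{v_p(x)}$. Schinzel's hypothesis (H): if $f_1,\dots,f_s\in\mathbb{Z}[X]$ are irreducible in $\mathbb{Q}[X]$, $\gcd\{f_1(x)\cdots f_s(x)\mid x\in\mathbb{Z}\}=1$ and $f_i(x)\to\infty$ as $x\to\infty$ for each $i$, then there is $x\in\mathbb{Z}$ with all $f_i(x)$ prime. *)

(* Defs.v *)
From HB Require Import structures.
From mathcomp Require Import all_boot all_order all_algebra.

Set Implicit Arguments.
Unset Strict Implicit.
Unset Printing Implicit Defensive.

Import Order.TTheory GRing.Theory Num.Theory.
Local Open Scope ring_scope.

(* p-adic valuation of a nonzero integer; the value at 0 is the junk value 0. *)
Definition vp (p : nat) (n : int) : nat := logn p `|n|%N.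

(* r_p(n) = n / p^{v_p(n)}; the division is exact, so for a nonzero integer n
   this is the restriction to the integers of the map r_p on Q_p^*. *)
Definition rp (p : nat) (n : int) : int := (n %/ (p ^ vp p n)%N%:Z)%Z.

Definition tends_to_pinfty (f : {poly int}) : Prop :=
  forall M : int, exists N : int, forall x : int, N <= x -> M <= f.[x].

(* The gcd condition says that only the units +1, -1 divide all the values
   f_1(x) ... f_s(x). *)
Definition SchinzelH : Prop :=
  forall fs : seq {poly int},
    (forall f, f \in fs ->
       irreducible_poly (map_poly (intr : int -> rat) f)) ->
    (forall d : int,
       (forall x : int, (d %| \prod_(f <- fs) f.[x])%Z) -> `|d|%N = 1%N) ->
    (forall f, f \in fs -> tends_to_pinfty f) ->
  exists x : int, forall f, f \in fs ->
    exists q : nat, prime q /\ f.[x] = q%:Z.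

(* n may be negative: the residue %[mod 8] on int is the non-negative one.
   In the sum, 0 ^+ 0 = 1. *)
Definition exceptional (a b : nat) (m : int) : Prop :=
  exists n : int,
    [/\ (n = 6 %[mod 8])%Z,
        m = n ^+ a
      & forall p : nat, prime p -> p = 3 %[mod 4] -> (p%:Z %| n)%Z ->
          [\/ ~~ (b %| vp p n)%N,
              (2 %| vp p n)%N
            | ~ exists z' : nat, (z' < p)%N /\
                (p%:Z %| \sum_(0 <= i < a)
                   rp p n ^+ (a - 1 - i) * z'%:Z ^+ (i * b))%Z]].

(* Main.v *)
Require Import Defs.
From HB Require Import structures.
From mathcomp Require Import all_boot all_order all_algebra.
From mathcomp Require Import all_fingroup all_field.
From mathcomp Require Import zify ring.
From Stdlib Require Import Classical.

(** Put [z = - t], so that the question is whether [f = X^k + m] takes a value that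
    is a sum of two squares.

    Necessity: if [m = n^a], then [m - z^k = (n - w) Q] with [w = z^b] and
    [Q = n^(a-1) + ... + w^(a-1)].  For [n = 6 mod 8], reduction modulo powers of 2
    leaves only [z = 3 mod 4], where [n - w] and [Q] are both [3 mod 4].  Then some
    prime [p = 3 mod 4] divides both factors to an odd power, and comparing
    valuations shows that [n] violates the condition at [p].

    Sufficiency: if [m] is neither an [a]-th nor a [b]-th power, [f] is irreducible;
    if [m = n^a] with [n] not a [b]-th power, [f] is the product of the two
    irreducible polynomials [X^b + n] and [Q(n, - X^b)].  Choose [t0] such that each
    factor takes at [t0] a value [d_i w_i] with [w_i = 1 mod 4] and [prod d_i] a sum
    of two squares; this is possible with [d_i] a power of 2, except for
    [n = 6 mod 8], where [d_i] is an odd power of the prime [p] given by the failure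
    of the condition.  Hypothesis (H), applied to the polynomials
    [f_i(t0 + N u) / d_i] with [N] highly divisible, makes all [w_i] primes
    [1 mod 4]. *)

Set Implicit Arguments.
Unset Strict Implicit.
Unset Printing Implicit Defensive.

Import Order.TTheory GRing.Theory Num.Theory.
Local Open Scope ring_scope.

(** * Sums of two squares *)

Lemma intr_Fp_eq0 (p : nat) (x : int) : prime p ->
  ((x%:~R : 'F_p) == 0) = (p %| x)%Z.
Proof.
move=> p_pr; rewrite dvdzE /= (dvdn_pcharf (pchar_Fp p_pr)).
by case: (intP x) => // n; rewrite ?NegzE ?rmorphN ?oppr_eq0 ?abszN.
Qed.

Lemma Fp_fermat (p : nat) (x : 'F_p) : prime p -> x != 0 -> x ^+ p.-1 = 1.
Proof.
move=> p_pr x0; have := expf_card x; rewrite card_Fp //.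
have -> : x ^+ p = x * x ^+ p.-1 by rewrite -exprS prednK ?prime_gt0.
by rewrite -[RHS]mulr1 => /(mulfI x0).
Qed.

(** With [q = 4 h + 1], the polynomial [X^(2h) - 1] cannot vanish at all [4 h] nonzero residues; a
    non-root [x] has [x^(2h) = -1] by Fermat, and [x^h] is the required square root. *)
Lemma Fp_sqrt_opp1 (q : nat) : prime q -> q = 1 %[mod 4] ->
  exists s : nat, (q %| s ^ 2 + 1)%N.
Proof.
move=> q_pr q1; pose h := (q %/ 4)%N.
have Dq : q = (h * 4).+1 by rewrite {1}(divn_eq q 4) q1 addn1.
have Dq1 : q.-1 = (h * 4)%N by rewrite Dq.
have h_gt0 : (0 < h)%N by case: (h) Dq q_pr => // ->.
pose P : {poly 'F_q} := 'X^(h * 2) - 1.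
have [x x0 Px] : exists2 x : 'F_q, x != 0 & ~~ root P x.
  apply/exists_inP; rewrite -negb_forall_in; apply/negP=> /forall_inP all_root.
  have P0 : P != 0 by rewrite -size_poly_gt0 size_XnsubC ?muln_gt0 ?h_gt0.
  have := max_poly_roots P0 (_ : all (root P) (enum [pred x : 'F_q | x != 0])) (enum_uniq _).
  rewrite size_XnsubC ?muln_gt0 ?h_gt0 // -cardE.
  have -> : #|[pred x : 'F_q | x != 0]| = (h * 4)%N.
    by have := cardC1 (0 : 'F_q); rewrite card_Fp // Dq1.
  have -> : all (root P) (enum [pred x : 'F_q | x != 0]).
    apply/allP=> x; rewrite mem_enum; exact: all_root.
  by move=> /(_ isT); lia.
have : (x ^+ (h * 2)) ^+ 2 = 1.
  by rewrite -exprM -mulnA -(Fp_fermat q_pr x0) Dq1.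
move/eqP; rewrite sqrf_eq1 => /orP[/eqP x1 | /eqP x1].
  by case/negP: Px; rewrite rootE !hornerE x1 subrr.
exists (x ^+ h : 'F_q); rewrite (dvdn_pcharf (pchar_Fp q_pr)) natrD natrX natr_Zp.
by rewrite -exprM x1 addNr.
Qed.

Definition sum2sq (m : int) := exists x y : int, m = x ^+ 2 + y ^+ 2.

Lemma sum2sqM (m n : int) : sum2sq m -> sum2sq n -> sum2sq (m * n).
Proof.
case=> x [y ->] [z [t ->]]; exists (x * z - y * t), (x * t + y * z); ring.
Qed.

Lemma sum2sq_sqr (m : int) : sum2sq (m ^+ 2).
Proof. by exists m, 0; rewrite expr0n addr0. Qed.

(* Thue's argument: two of the [(k + 1) ^ 2 > q] residues [i + s * j] coincide. *)
Lemma sum2sq_prime (q : nat) : prime q -> q = 1 %[mod 4] -> sum2sq q.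
Proof.
move=> q_pr q1; have [s q_s] := Fp_sqrt_opp1 q_pr q1.
have q_gt1 := prime_gt1 q_pr.
have [k k_le k_gt] : exists2 k, (k ^ 2 <= q)%N & (q < k.+1 ^ 2)%N.
  have ex_k : exists k, (k ^ 2 <= q)%N by exists 0%N.
  have ub k : (k ^ 2 <= q)%N -> (k <= q)%N by nia.
  case: (ex_maxnP ex_k ub) => k k_le k_max; exists k => //.
  by rewrite ltnNge; apply/negP=> /k_max; rewrite ltnn.
(* A prime is not a square; strictness gives [x^2 + y^2 < 2 q] below, so that this multiple of [q]
   is [q] itself. *)
have k_lt : (k ^ 2 < q)%N.
  rewrite ltn_neqAle k_le andbT; apply/eqP=> Dq; move: q_pr; rewrite -Dq.
  case/primeP=> k2_gt1 /(_ k); rewrite dvdn_exp // => /(_ isT) /pred2P[] Dk.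
    by rewrite Dk in k2_gt1.
  nia.
pose F (ij : 'I_k.+1 * 'I_k.+1) : 'I_q := Ordinal (ltn_pmod (ij.1 + s * ij.2) (ltnW q_gt1)).
have /injectivePn[[i j] [[i' j'] ij' F_ij]] : ~~ injectiveb F.
  apply: contraL k_gt => /injectiveP/leq_card.
  by rewrite card_prod !card_ord -leqNgt mulnn.
pose x : int := i%:Z - i'%:Z; pose y : int := j%:Z - j'%:Z.
have q_xy : (q %| x + s%:Z * y)%Z.
  move/(congr1 val): F_ij => /= F_ij.
  have -> : x + s%:Z * y = (i + s * j)%N%:Z - (i' + s * j')%N%:Z.
    by rewrite /x /y !PoszD !PoszM; ring.
  by rewrite -eqz_mod_dvd !modz_nat F_ij.
have q_x2y2 : (q %| x ^+ 2 + y ^+ 2)%Z.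
  have -> : x ^+ 2 + y ^+ 2 =
      (x + s%:Z * y) * (x - s%:Z * y) + (s%:Z ^+ 2 + 1) * y ^+ 2 by ring.
  by rewrite rpredD ?dvdz_mulr.
have : x ^+ 2 + y ^+ 2 < 2 * q%:Z.
  have sqr_le (u v : 'I_k.+1) : (u%:Z - v%:Z) ^+ 2 <= k%:Z ^+ 2.
    have [u_lt v_lt] := (ltn_ord u, ltn_ord v).
    by rewrite -subr_ge0 subr_sqr mulr_ge0; clear -u_lt v_lt; lia.
  have [x_le y_le] := (sqr_le i i', sqr_le j j').
  have : k%:Z ^+ 2 < q%:Z by rewrite -natz -natrX natz.
  rewrite -/x -/y in x_le y_le; move: (x ^+ 2) (y ^+ 2) (k%:Z ^+ 2) x_le y_le; clear; lia.
have : 0 < x ^+ 2 + y ^+ 2.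
  rewrite lt_neqAle addr_ge0 ?sqr_ge0 // andbT eq_sym paddr_eq0 ?sqr_ge0 //.
  rewrite !sqrf_eq0 !subr_eq0; apply: contraNN ij' => /andP[/eqP[/val_inj->] /eqP[/val_inj->]].
  by [].
case/dvdzP: q_x2y2 => c Dc c_gt0 c_lt2; exists x, y; rewrite Dc.
suff -> : c = 1 by rewrite mul1r.
have q_gt0 : 0 < q%:Z by rewrite ltz_nat prime_gt0.
by move: c_gt0 c_lt2; rewrite Dc pmulr_lgt0 // ltr_pM2r //; lia.
Qed.

(** Otherwise [x / y] would be a square root of -1 modulo [p]; as [(p - 1) / 2] is odd, Fermat would
    give [-1 = 1]. *)
Lemma dvdz_sum2sq (p : nat) (x y : int) : prime p -> p = 3 %[mod 4] ->
  (p %| x ^+ 2 + y ^+ 2)%Z -> (p %| y)%Z.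
Proof.
move=> p_pr p3; rewrite -!intr_Fp_eq0 // rmorphD !rmorphXn /= addr_eq0 => /eqP Dxy.
apply: contraTT isT => y0; pose z : 'F_p := x%:~R / y%:~R.
have z2 : z ^+ 2 = -1 by rewrite expr_div_n Dxy mulNr mulfV // expf_neq0.
pose h := (p %/ 4)%N; have Dp : p = (h * 4 + 3)%N by rewrite {1}(divn_eq p 4) p3.
have z0 : z != 0 by apply: contra_eq_neq z2 => ->; rewrite expr0n eq_sym oppr_eq0 oner_eq0.
have := Fp_fermat p_pr z0; have -> : p.-1 = (2 * (h * 2).+1)%N by lia.
rewrite exprM z2 exprS mulnC exprM sqrrN !expr1n mulr1 => /eqP.
rewrite -subr_eq0 -opprD oppr_eq0 -(natrD _ 1 1) -(dvdn_pcharf (pchar_Fp p_pr)).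
by rewrite dvdn_prime2 // Dp => /eqP; lia.
Qed.

(** Descent: if [p] divides [m], it divides both [x] and [y], and [m / p^2] is again a sum of two
    squares. *)
Lemma logn_sum2sq_even (p : nat) (m : int) : prime p -> p = 3 %[mod 4] ->
  m != 0 -> sum2sq m -> ~~ odd (logn p `|m|%N).
Proof.
move=> p_pr p3; have [n] := ubnP `|m|%N; elim: n m => // n IHn m.
rewrite ltnS => m_n m0 [x [y Dm]].
have [p_m | p'm] := boolP (p %| m)%Z; last first.
  by rewrite lognE dvdzE /= in p'm *; rewrite (negbTE p'm) !andbF.
have p_y : (p %| y)%Z by apply: (dvdz_sum2sq p_pr p3 (x := x)); rewrite -Dm.
have p_x : (p %| x)%Z by apply: (dvdz_sum2sq p_pr p3 (x := y)); rewrite addrC -Dm.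
have [[x' Dx] [y' Dy]] := (dvdzP p_x, dvdzP p_y).
have {}Dm : m = p%:Z ^+ 2 * (x' ^+ 2 + y' ^+ 2) by rewrite Dm Dx Dy; ring.
have m'0 : x' ^+ 2 + y' ^+ 2 != 0 by apply: contraNneq m0 => m'0; rewrite Dm m'0 mulr0.
have p_gt1 := prime_gt1 p_pr.
rewrite Dm abszM abszX absz_nat lognM ?expn_gt0 ?absz_gt0 ?(ltnW p_gt1) // lognX.
rewrite (logn_prime p p_pr) eqxx oddD /=; apply: IHn => //; last by exists x', y'.
apply: leq_trans m_n; rewrite Dm abszM abszX absz_nat.
by rewrite ltn_Pmull ?absz_gt0 // -[1%N](exp1n 2) ltn_exp2r.
Qed.

(** Otherwise every prime power in the factorization of [N] would be 1 modulo 4, being a power of a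
    prime [1 mod 4] or an even power of a prime [3 mod 4]. *)
Lemma exists_odd_logn (N : nat) : N = 3 %[mod 4] ->
  exists p, [/\ prime p, p = 3 %[mod 4] & odd (logn p N)].
Proof.
move=> N3; have N_gt0 : (0 < N)%N by case: (N) N3.
have N_odd : odd N by lia.
have [/hasP[p _ /andP[p_pr /andP[/eqP p3 p_N]]] | /hasPn no_odd] :=
  boolP (has (fun p => prime p && ((p %% 4 == 3)%N && odd (logn p N))) (primes N)).
  by exists p.
suff : N = 1 %[mod 4] by rewrite N3.
rewrite [in LHS](prod_prime_decomp N_gt0) prime_decompE big_map big_seq.
elim/big_ind: _ => // [m n m1 n1|p p_N /=]; first by rewrite -modnMm m1 n1.
have := no_odd p p_N; have := p_N; rewrite mem_primes => /and3P[p_pr _ p_dvN].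
rewrite p_pr /= negb_and -modnXm.
have /orP[/eqP -> | /eqP ->] : (p %% 4 == 1)%N || (p %% 4 == 3)%N.
- by have := dvdn_odd p_dvN N_odd; lia.
- by rewrite exp1n.
- by move=> /= /even_halfK <-; rewrite -muln2 mulnC expnM -modnXm exp1n.
Qed.

(** A sum of two squares is nonnegative, so [w] is positive and some prime [3 mod 4] has an odd
    exponent in it; the factor [2^i] does not change that exponent. *)
Lemma not_sum2sq (m w : int) (i : nat) :
  m = 2 ^+ i * w -> (w = 3 %[mod 4])%Z -> ~ sum2sq m.
Proof.
move=> Dm w3 m_sum; have m_ge0 : 0 <= m.
  by case: m_sum => x [y ->]; rewrite addr_ge0 ?sqr_ge0.
have w0 : w != 0 by apply/eqP=> w0; rewrite w0 in w3.
have m0 : m != 0 by rewrite Dm mulf_neq0 // expf_neq0.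
have w_gt0 : 0 < w.
  by rewrite lt0r w0 -(pmulr_rge0 _ (_ : 0 < 2 ^+ i)) -?Dm // exprn_gt0.
have [p [p_pr p3 p_w]] : exists p, [/\ prime p, p = 3 %[mod 4] & odd (logn p `|w|%N)].
  by apply: exists_odd_logn; lia.
have := logn_sum2sq_even p_pr p3 m0 m_sum.
rewrite Dm abszM abszX lognM ?expn_gt0 ?absz_gt0 // lognX.
rewrite (logn_prime p (isT : prime 2)) (_ : (p == 2) = false) ?muln0 ?p_w //.
by apply: contra_eqF p3 => /eqP ->.
Qed.

(** * The homogeneous sum [x^(a-1) + x^(a-2) y + ... + y^(a-1)] *)

Definition homsum (R : comPzRingType) (a : nat) (x y : R) : R :=
  \sum_(0 <= i < a) x ^+ (a - 1 - i) * y ^+ i.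

Section Homsum.
Variables (R : comPzRingType) (a : nat).
Implicit Types x y c : R.

Lemma mul_homsum x y : (x - y) * homsum a x y = x ^+ a - y ^+ a.
Proof. by rewrite subrXX /homsum big_mkord subn1. Qed.

Lemma homsumZ c x y : homsum a (c * x) (c * y) = c ^+ (a - 1) * homsum a x y.
Proof.
rewrite /homsum big_distrr /=; apply: eq_big_nat => i /andP[_ lt_ia].
have -> : c ^+ (a - 1) = c ^+ (a - 1 - i) * c ^+ i.
  by rewrite -exprD subnK //; lia.
by rewrite !exprMn; ring.
Qed.

Lemma homsum_diag x : homsum a x x = a%:R * x ^+ (a - 1).
Proof.
rewrite /homsum (eq_big_nat _ _ (F2 := fun=> x ^+ (a - 1))) => [|i /andP[_ lt_ia]].
  by rewrite sumr_const_nat subn0 mulr_natl.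
by rewrite -exprD subnK //; lia.
Qed.

Lemma homsumx0 x : (0 < a)%N -> homsum a x 0 = x ^+ (a - 1).
Proof.
move=> a_gt0; rewrite /homsum big_ltn // subn0 expr0 mulr1 big_nat big1 ?addr0 //.
by move=> i /andP[i_gt0 _]; rewrite expr0n gtn_eqF ?mulr0.
Qed.

Lemma homsum0x y : (0 < a)%N -> homsum a 0 y = y ^+ (a - 1).
Proof.
case: a => // n _; rewrite /homsum subn1 big_nat_recr //= subnn expr0 mul1r.
rewrite big_nat big1 ?add0r // => i /andP[_ lt_in].
by rewrite expr0n subn_eq0 leqNgt lt_in mul0r.
Qed.

End Homsum.

Lemma rmorph_homsum (R S : comPzRingType) (f : {rmorphism R -> S}) (a : nat) (x y : R) :
  f (homsum a x y) = homsum a (f x) (f y).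
Proof. by rewrite rmorph_sum; apply: eq_bigr => i _; rewrite rmorphM !rmorphXn. Qed.

(** * Valuations and odd powers *)

Lemma vp_rp (p : nat) (n : int) : prime p -> n != 0 ->
  n = p%:Z ^+ vp p n * rp p n /\ ~~ (p %| rp p n)%Z.
Proof.
move=> p_pr n0; have Dn : n = p%:Z ^+ vp p n * rp p n.
  rewrite mulrC /rp -natz natrX natz.
  by rewrite divzK // dvdzE abszX pfactor_dvdnn.
split=> //; apply/negP=> /dvdzP[q Dq].
have : (p ^ (vp p n).+1 %| `|n|)%N.
  rewrite {2}Dn Dq mulrCA -exprSr abszM abszX absz_nat dvdn_mull //.
by rewrite pfactor_dvdn ?absz_gt0 // ltnn.
Qed.

Lemma logn_pexpM (p e : nat) (u : int) : prime p -> ~~ (p %| u)%Z ->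
  logn p `|(p%:Z ^+ e * u)%R|%N = e.
Proof.
move=> p_pr p'u; have u0 : u != 0 by apply: contraNneq p'u => ->; rewrite dvdz0.
have pe_gt0 : (0 < p ^ e)%N by rewrite expn_gt0 prime_gt0.
rewrite abszM abszX absz_nat lognM ?absz_gt0 // pfactorK //.
by rewrite dvdzE in p'u; rewrite lognE (negbTE p'u) !andbF addn0.
Qed.

Lemma prime_1mod4_gt4 (a : nat) : prime a -> a = 1 %[mod 4] -> (4 < a)%N.
Proof. by case: a => [|[|[|[|[|]]]]]. Qed.

Lemma prime_1mod4_odd (a : nat) : a = 1 %[mod 4] -> odd a.
Proof. lia. Qed.

(** The square of an odd integer is 1 modulo 8. *)
Lemma exp_odd_mod8 (z : int) (e : nat) : odd e -> (z %% 2 = 1)%Z ->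
  (z ^+ e = z %[mod 8])%Z.
Proof.
move=> e_odd z_odd; rewrite -(odd_double_half e) e_odd -muln2 mulnC addnC addn1.
rewrite exprS exprM -modzMmr -modzXm; have -> : (z ^+ 2 %% 8 = 1)%Z.
  have [[q Dq] | [q Dq]] : (exists q, z = 4 * q + 1) \/ (exists q, z = 4 * q + 3).
    have [z1 | z3] : (z %% 4 = 1)%Z \/ (z %% 4 = 3)%Z by lia.
      by left; exists (z %/ 4)%Z; lia.
    by right; exists (z %/ 4)%Z; lia.
  - by rewrite Dq (_ : _ ^+ 2 = (2 * q ^+ 2 + q) * 8 + 1) ?modzMDl //; ring.
  - by rewrite Dq (_ : _ ^+ 2 = (2 * q ^+ 2 + 3 * q + 1) * 8 + 1) ?modzMDl //; ring.
by rewrite expr1n modzMmr mulr1.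
Qed.

Lemma exp_odd_mod4 (z : int) (e : nat) : odd e -> (z %% 2 = 1)%Z ->
  (z ^+ e = z %[mod 4])%Z.
Proof. by move=> e_odd z_odd; have := exp_odd_mod8 e_odd z_odd; lia. Qed.

Lemma ltr_odd_exp (R : realDomainType) (x y : R) (e : nat) : odd e ->
  x < y -> x ^+ e < y ^+ e.
Proof.
move=> e_odd xy; have e0 : e != 0%N by case: (e) e_odd.
have [x_ge0 | x_lt0] := leP 0 x; first by rewrite ltrXn2r // (le_trans x_ge0) ?ltW.
have [y_ge0 | y_lt0] := leP 0 y.
  by apply: lt_le_trans (exprn_ge0 _ y_ge0); rewrite exprn_odd_lt0.
have neg z : - (z ^+ e) = (- z) ^+ e :> R by rewrite [RHS]exprNn -signr_odd e_odd mulN1r.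
by rewrite -ltrN2 !neg ltrXn2r ?oppr_ge0 ?ltW ?ltrN2.
Qed.

(** * Necessity *)

Lemma prime_3mod4_ndvd (p a : nat) : prime p -> prime a ->
  p = 3 %[mod 4] -> a = 1 %[mod 4] -> ~~ (p %| a)%N.
Proof.
move=> p_pr a_pr p3 a1; rewrite dvdn_prime2 //.
by apply: contraTN isT => /eqP Dp; rewrite Dp a1 in p3.
Qed.

(** Modulo [p] the sum becomes [a x^(a-1)], a product of units. *)
Lemma homsum_diag_ndvd (p a : nat) (x y : int) : prime p -> ~~ (p %| a)%N ->
  (p %| x - y)%Z -> ~~ (p %| x)%Z -> ~~ (p %| homsum a x y)%Z.
Proof.
move=> p_pr p'a; rewrite -!intr_Fp_eq0 // rmorphB subr_eq0 => /eqP Dxy x0.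
rewrite rmorph_homsum -Dxy homsum_diag mulf_eq0 expf_eq0 (negbTE x0) andbF orbF.
by rewrite -(dvdn_pcharf (pchar_Fp p_pr)).
Qed.

(** If [n] and [z^b] had different valuations, that of the homogeneous sum would be [a - 1] times
    the smaller, hence even. So both equal [v_p(n)], and after division by this power of [p] the sum
    is still divisible by [p]; then [r - s^b] is a unit at [p], and [v_p(n - z^b) = v_p(n)]. *)
Lemma homsum_odd_logn (p a b : nat) (n z : int) : prime p -> prime a ->
  p = 3 %[mod 4] -> a = 1 %[mod 4] -> n != 0 -> z != 0 ->
  odd (logn p `|n - z ^+ b|%N) -> odd (logn p `|homsum a n (z ^+ b)|%N) ->
  [/\ (p %| n)%Z, (b %| vp p n)%N, odd (vp p n) &
    exists s : int, (p %| homsum a (rp p n) (s ^+ b))%Z].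
Proof.
move=> p_pr a_pr p3 a1 n0 z0 odd_B odd_Q.
have a_gt0 := prime_gt0 a_pr; have p'a := prime_3mod4_ndvd p_pr a_pr p3 a1.
have a'_even : ~~ odd (a - 1) by have := prime_1mod4_odd a1; clear -a_gt0; lia.
have dvd_of_odd (x : int) : odd (logn p `|x|%N) -> (p %| x)%Z.
  by rewrite lognE dvdzE /=; case: ifP => // /and3P[].
have p_B := dvd_of_odd _ odd_B; have p_Q := dvd_of_odd _ odd_Q.
have p_n : (p %| n)%Z.
  by apply: contraLR p_Q; apply: homsum_diag_ndvd.
have [Dn p'r] := vp_rp p_pr n0; have [Dz p's] := vp_rp p_pr z0.
set al := vp p n in Dn *; set r := rp p n in Dn p'r *.
set be := vp p z in Dz; set s := rp p z in Dz p's.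
have p'sb : ~~ (p %| s ^+ b)%Z.
  by rewrite -intr_Fp_eq0 // rmorphXn expf_eq0 /= negb_and intr_Fp_eq0 // p's orbT.
have Dw : z ^+ b = p%:Z ^+ (be * b) * s ^+ b by rewrite Dz exprMn exprM.
have [lt_ab | lt_ba | Dab] := ltngtP al (be * b)%N.
- case/negP: a'_even; move: odd_Q; rewrite Dn Dw -(subnKC (ltnW lt_ab)) exprD -mulrA.
  rewrite homsumZ -exprM logn_pexpM //; first by rewrite oddM => /andP[].
  rewrite -intr_Fp_eq0 // rmorph_homsum rmorphM rmorphXn /=.
  have /eqP -> : ((p%:Z)%:~R : 'F_p) == 0 by rewrite intr_Fp_eq0.
  rewrite expr0n gtn_eqF ?subn_gt0 // mul0r homsumx0 // expf_eq0 intr_Fp_eq0 //.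
  by rewrite negb_and p'r orbT.
- case/negP: a'_even; move: odd_Q; rewrite Dn Dw -(subnKC (ltnW lt_ba)) exprD -mulrA.
  rewrite homsumZ -exprM logn_pexpM //; first by rewrite oddM => /andP[].
  rewrite -intr_Fp_eq0 // rmorph_homsum rmorphM rmorphXn /=.
  have /eqP -> : ((p%:Z)%:~R : 'F_p) == 0 by rewrite intr_Fp_eq0.
  rewrite expr0n gtn_eqF ?subn_gt0 // mul0r homsum0x // expf_eq0 intr_Fp_eq0 //.
  by rewrite negb_and p'sb orbT.
have p_Q' : (p %| homsum a r (s ^+ b))%Z.
  apply: contraLR odd_Q => p'Q'; rewrite Dn Dw -Dab homsumZ -exprM logn_pexpM //.
  by rewrite oddM (negbTE a'_even) andbF.
split=> //; first by rewrite Dab dvdn_mull.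
  move: odd_B; rewrite Dn Dw -Dab -mulrBr logn_pexpM //.
  by apply: contraL p_Q' => p_rs; apply: homsum_diag_ndvd.
by exists s.
Qed.

Lemma not_exceptional (a b : nat) (m z : int) :
  prime a -> prime b -> a = 1 %[mod 4] -> b = 1 %[mod 4] ->
  sum2sq (m - z ^+ (a * b)) -> ~ exceptional a b m.
Proof.
move=> a_pr b_pr a1 b1 sum_mz [n [n6 Dm Hp]].
have [a_odd b_odd] := (prime_1mod4_odd a1, prime_1mod4_odd b1).
have [a_gt4 b_gt4] := (prime_1mod4_gt4 a_pr a1, prime_1mod4_gt4 b_pr b1).
have [z_even | z_odd] : (z %% 2 = 0)%Z \/ (z %% 2 = 1)%Z by clear; lia.
  (* For even [z], [z^(a b)] is a multiple of [2^(a + 2)], so [m - z^(a b)] is [2^a] times an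
     integer [3 mod 4]. *)
  pose n' := (n %/ 2)%Z; pose z' := (z %/ 2)%Z.
  have [Dn n'3] : n = 2 * n' /\ (n' %% 4 = 3)%Z by rewrite /n'; clear -n6; lia.
  have Dz : z = 2 * z' by rewrite /z'; clear -z_even; lia.
  have Dab : (a * b = a + (2 + (a * b.-1 - 2)))%N.
    by clear -a_gt4 b_gt4; case: b b_gt4 => // b'; nia.
  apply: (@not_sum2sq _ (n' ^+ a - 4 * (2 ^+ (a * b.-1 - 2) * z' ^+ (a * b))) a _ _ sum_mz).
    rewrite Dm Dn Dz !exprMn {1}Dab !exprD mulrBr; congr (_ - _); rewrite !mulrA.
    by congr (_ * _ * _); rewrite -mulrA.
  rewrite -modzDmr -modzNm modzMr oppr0 mod0z addr0.
  by rewrite (exp_odd_mod4 a_odd) ?n'3 //; clear -n'3; lia.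
have z0 : z != 0 by apply: contra_eqN z_odd => /eqP ->.
have n0 : n != 0 by apply: contra_eqN n6 => /eqP ->.
have ab_odd : odd (a * b) by rewrite oddM a_odd.
have na0 : (n ^+ a %% 4 = 0)%Z.
  have [q Dn] : exists q, n = 2 * q by exists (n %/ 2)%Z; clear -n6; lia.
  have a_ge2 : (2 <= a)%N by clear -a_gt4; lia.
  by rewrite Dn exprMn -(subnKC a_ge2) exprD -mulrA modzMr.
have zab : (z ^+ (a * b) = z %[mod 4])%Z by apply: exp_odd_mod4.
(* As 4 divides [n^a], [z = 1 mod 4] would make [m - z^(a b)] equal to 3 modulo 4. *)
have z3 : (z %% 4 = 3)%Z.
  have [z1|//] : (z %% 4 = 1)%Z \/ (z %% 4 = 3)%Z by clear -z_odd; lia.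
  case: (@not_sum2sq _ (m - z ^+ (a * b)) 0 _ _ sum_mz); first by rewrite mul1r.
  by rewrite Dm; clear -na0 zab z1; lia.
pose w := z ^+ b; have w3 : (w %% 4 = 3)%Z by rewrite /w exp_odd_mod4.
have Dmz : m - z ^+ (a * b) = (n - w) * homsum a n w.
  by rewrite mul_homsum -exprM mulnC Dm.
have mz0 : m - z ^+ (a * b) != 0.
  by rewrite Dm; apply/eqP; clear -na0 zab z3; lia.
have mz_ge0 : 0 <= m - z ^+ (a * b).
  by case: sum_mz => x [y ->]; rewrite addr_ge0 ?sqr_ge0.
(* The sign matters: [n - w] is [3 mod 4], and its absolute value is so only because it is
   positive. *)
have nw_gt0 : w < n.
  rewrite ltNge le_eqVlt negb_or; apply/andP; split.
    by apply: contraNneq mz0 => Dw; rewrite Dmz Dw subrr mul0r.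
  apply/negP=> /(ltr_odd_exp a_odd); rewrite -exprM mulnC -Dm => lt_m.
  by move: mz_ge0; rewrite subr_ge0 leNgt lt_m.
have [p [p_pr p3 odd_B]] : exists p, [/\ prime p, p = 3 %[mod 4] & odd (logn p `|n - w|%N)].
  by apply: exists_odd_logn; clear -nw_gt0 n6 w3; lia.
have := logn_sum2sq_even p_pr p3 mz0 sum_mz; rewrite Dmz.
move: mz0; rewrite Dmz mulf_eq0 negb_or => /andP[nw0 Q0].
rewrite abszM lognM ?absz_gt0 // oddD odd_B negbK => odd_Q.
have [p_n b_vp odd_vp [s p_Q]] := homsum_odd_logn p_pr a_pr p3 a1 n0 z0 odd_B odd_Q.
have [] := Hp p p_pr p3 p_n; rewrite ?b_vp // ?dvdn2 ?odd_vp //; case.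
have p0 : p%:Z != 0 by rewrite -lt0n prime_gt0.
have [s' Ds'] : exists s' : nat, (s %% p)%Z = s'%:Z.
  by exists `|(s %% p)%Z|%N; rewrite gez0_abs ?modz_ge0.
exists s'; split; first by rewrite -ltz_nat -Ds' ltz_pmod // ltz_nat prime_gt0.
rewrite -intr_Fp_eq0 // in p_Q.
rewrite (_ : \sum_(0 <= i < a) _ = homsum a (rp p n) (s'%:Z ^+ b)); last first.
  by apply: eq_bigr => i _; rewrite mulnC exprM.
have Dss' : (s'%:Z%:~R : 'F_p) = s%:~R.
  apply/eqP; rewrite -subr_eq0 -rmorphB intr_Fp_eq0 // -Ds' -eqz_mod_dvd modz_mod //.
by rewrite -intr_Fp_eq0 //; move: p_Q; rewrite !rmorph_homsum !rmorphXn /= Dss'.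
Qed.

(** * Irreducibility over the rationals *)

(** The conjugates of [x] generate a number field that is Galois over the rationals. Its
    automorphisms extend to [algC], so [x] lies in the fixed field of the Galois group. *)
Lemma aut_fixed_Crat (x : algC) :
  (forall u : {rmorphism algC -> algC}, u x = x) -> x \in Crat.
Proof.
move=> fix_x.
have [p [Dp mon_p] min_p] := minCpolyP x.
have [r Dr] := closed_field_poly_normal (minCpoly x).
rewrite (monicP (minCpoly_monic x)) scale1r in Dr.
have [L [LC [s Ds genL]]] := num_field_exists r.
pose q := map_poly (in_alg L) p.
have LCq : map_poly LC q = minCpoly x.
  rewrite /q -map_poly_comp Dp; apply: eq_map_poly => c /=.
  by rewrite alg_num_field fmorph_rat.
have q1 : q \is a polyOver 1%VS.
  by apply/polyOverP=> i; rewrite coef_map /= rpredZ ?mem1v.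
have Dq : q = \prod_(y <- s) ('X - y%:P).
  apply: (map_poly_inj LC); rewrite LCq Dr -Ds big_map rmorph_prod /=.
  by apply: eq_bigr => y _; rewrite map_polyXsubC.
have split_q : splittingFieldFor 1 q {:L}.
  by exists s => //; rewrite Dq eqpxx.
have L_ax : FieldExt_isSplittingField _ L by constructor; exists q.
pose Ls : splittingFieldType rat := HB.pack_for (splittingFieldType rat) L L_ax.
have galL : galois 1 {:Ls}.
  apply/and3P; split; first exact: sub1v.
    apply/separableP=> y _; apply: pcharf0_separable.
    by move=> ?; rewrite -(fmorph_pchar LC) pchar_num.
  by apply/splitting_normalField; [exact: sub1v | exists q].
have /mapP[y s_y Dx]: x \in map LC s.
  by rewrite Ds -root_prod_XsubC -Dr root_minCpoly.
have : (y : Ls) \in fixedField 'Gal({:Ls} / 1)%g.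
  apply/fixedFieldP=> [|nu _]; first exact: memvf.
  have [nuC DnuC] := extend_algC_subfield_aut LC nu.
  by apply: (fmorph_inj LC); rewrite DnuC -Dx fix_x.
rewrite (galois_fixedField galL) => /vlineP[c Dy].
by rewrite Dx Dy alg_num_field fmorph_rat Crat_rat.
Qed.

(** [t] is a rational algebraic integer, hence an integer. *)
Lemma int_root_of_rat (k : nat) (c : int) (t : algC) :
  (0 < k)%N -> t \in Crat -> t ^+ k = c%:~R -> exists y : int, c = y ^+ k.
Proof.
move=> k_gt0 t_rat Dt.
have t_Aint : t \in Aint.
  apply: (@root_monic_Aint ('X^k - (c%:~R)%:P)).
  - by rewrite rootE !hornerE Dt subrr.
  - exact: monicXnsubC.
  - apply/polyOverP=> i; rewrite coefB coefC -mulrb coefXn.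
    by rewrite rpredB ?rpred_nat ?rpredMn ?rpred_int.
have /intrP[y Dy] := Cint_rat_Aint t_rat t_Aint.
by exists y; apply: (@intr_inj algC); rewrite rmorphXn /= -Dy.
Qed.

Lemma int_root_of_rat_norm (k : nat) (c : int) (t : algC) :
  odd k -> t \in Crat -> t ^+ k = `|c|%:~R -> exists y : int, c = y ^+ k.
Proof.
move=> k_odd t_rat /(int_root_of_rat _ t_rat)[|y Dy]; first by case: (k) k_odd.
case: (ger0P c) Dy => [_ -> | _ Dy]; first by exists y.
by exists (- y); rewrite exprNn -signr_odd k_odd expr1 mulN1r -Dy opprK.
Qed.

Lemma Crat_exp_gcd (t : algC) (d k : nat) :
  t != 0 -> (0 < d)%N -> t ^+ d \in Crat -> t ^+ k \in Crat ->
  t ^+ gcdn d k \in Crat.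
Proof.
move=> t0 d_gt0 td tk; case: (egcdnP k d_gt0) => u v Duv _.
suff -> : t ^+ gcdn d k = (t ^+ d) ^+ u / (t ^+ k) ^+ v.
  by apply: rpredM; rewrite ?rpredV rpredX.
by rewrite -!exprM mulnC Duv mulnC addnC exprD mulfK // expf_neq0.
Qed.

(** Up to sign, the product of the roots is the constant coefficient over the leading one; its
    modulus is [t ^+ size r]. *)
Lemma Crat_exp_root_norm (q : {poly rat}) (r : seq algC) (t : algC) :
  q != 0 -> map_poly ratr q = lead_coef (map_poly ratr q) *: \prod_(z <- r) ('X - z%:P) ->
  (forall z, z \in r -> `|z| = t) -> t ^+ size r \in Crat.
Proof.
move=> q0 Dq r_t; pose C : {rmorphism rat -> algC} := ratr.
have : `|C (q.[0] / lead_coef q)| = t ^+ size r.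
  rewrite fmorph_div /= -horner_map rmorph0 -lead_coef_map.
  rewrite [X in X.[_]]Dq hornerZ mulrAC mulfV ?mul1r; last first.
    by rewrite lead_coef_eq0 map_poly_eq0.
  rewrite horner_prod normr_prod (eq_big_seq (fun=> t)).
    by rewrite big_const_seq count_predT iter_mulr_1.
  by move=> z /r_t <-; rewrite !hornerE normrN.
by move <-; rewrite -[`|_|]/(`|C _|) -ratr_norm Crat_rat.
Qed.

(* All the roots have modulus [|c| ^ (1 / k)], so a rational factor of degree [d]
   forces [|c| ^ (d / k)], hence [|c| ^ (gcd(d, k) / k)], to be rational. *)
Lemma irreducible_Xn_addC (k : nat) (c : int) : odd k -> (1 < k)%N ->
  (forall p : nat, prime p -> (p %| k)%N -> forall y : int, c <> y ^+ p) ->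
  irreducible_poly (map_poly (intr : int -> rat) ('X^k + c%:P)).
Proof.
move=> k_odd k_gt1 c_npow; rewrite rmorphD rmorphXn /= map_polyX map_polyC /=.
have k_gt0 := ltnW k_gt1.
have c0 : c != 0.
  apply/eqP=> c0; have := c_npow _ (pdiv_prime k_gt1) (pdiv_dvd k) 0.
  by rewrite c0 expr0n gtn_eqF ?pdiv_gt0.
split=> [|q sz_q dv_q]; first by rewrite size_XnaddC.
have p0 : 'X^k + (c%:~R)%:P != 0 :> {poly rat} by rewrite -size_poly_eq0 size_XnaddC.
have q0 : q != 0 by apply: contraNneq p0 => q0; rewrite q0 dvd0p in dv_q.
have [r Dr] := closed_field_poly_normal (map_poly (ratr : rat -> algC) q).
have sz_r : size q = (size r).+1.
  by rewrite -(size_map_poly (ratr : {rmorphism rat -> algC})) Dr size_scale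
    ?size_prod_XsubC // lead_coef_eq0 map_poly_eq0.
pose t : algC := k.-root (`|c|%:~R).
have t_ge0 : 0 <= t by rewrite rootC_ge0 // ler0z.
have Dt : t ^+ k = `|c|%:~R by rewrite rootCK.
have t0 : t != 0 by rewrite rootC_eq0 // intr_eq0 normr_eq0.
have r_t z : z \in r -> `|z| = t.
  move=> r_z; have /eqP : root (map_poly ratr ('X^k + (c%:~R)%:P : {poly rat})) z.
    have /dvdpP[g ->] := dv_q; rewrite rmorphM rootM /= Dr rootZ.
      by rewrite root_prod_XsubC r_z orbT.
    by rewrite lead_coef_eq0 map_poly_eq0.
  rewrite rmorphD rmorphXn /= map_polyX map_polyC /= ratr_int !hornerE.
  move/eqP; rewrite addr_eq0 => /eqP Dz.
  apply: (pexpIrn k_gt0); rewrite ?nnegrE // -normrX Dz normrN Dt.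
  by rewrite intr_norm.
have t_d := Crat_exp_root_norm q0 Dr r_t.
have sz_r0 : (0 < size r)%N by case: (size r) sz_r sz_q => // ->.
rewrite -dvdp_size_eqp // size_XnaddC // sz_r eqSS.
have := dvdp_leq p0 dv_q; rewrite size_XnaddC // sz_r ltnS leq_eqVlt.
case: eqP => //= _ r_lt_k; have {t_d}t_g : t ^+ gcdn (size r) k \in Crat.
  by apply: Crat_exp_gcd; rewrite // Dt rpred_int.
have g_lt_k : (gcdn (size r) k < k)%N.
  by apply: leq_ltn_trans r_lt_k; rewrite dvdn_leq ?dvdn_gcdl.
(* With [g] the gcd, [j = k / g] and [p = pdiv j], the rational number [t^(g j / p)] has [p]-th
   power [t^k = |c|], so [c] is a [p]-th power. *)
have /dvdnP[j Dk] := dvdn_gcdr (size r) k.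
have j_gt1 : (1 < j)%N by case: j Dk g_lt_k => [|[]] //; lia.
have /dvdnP[i Dj] := pdiv_dvd j; have p_pr := pdiv_prime j_gt1.
have dv_pk : (pdiv j %| k)%N by rewrite Dk dvdn_mulr ?pdiv_dvd.
have [|||y Dy] := @int_root_of_rat_norm (pdiv j) c (t ^+ gcdn (size r) k ^+ i).
- exact: dvdn_odd dv_pk k_odd.
- by rewrite rpredX.
- by rewrite -Dt -!exprM; congr (_ ^+ _); rewrite [RHS]Dk {2}Dj; lia.
by case: (c_npow _ p_pr dv_pk y).
Qed.

(** For odd [a], this is the quotient of [X^(a b) + n^a] by [X^b + n]. *)
Definition hom_cofactor (a b : nat) (n : int) : {poly int} := homsum a n%:P (- 'X^b).

Lemma mul_hom_cofactor (a b : nat) (n : int) : odd a ->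
  ('X^b + n%:P) * hom_cofactor a b n = 'X^(a * b) + (n ^+ a)%:P.
Proof.
move=> a_odd; rewrite addrC -[X in n%:P + X]opprK mul_homsum exprNn.
by rewrite -signr_odd a_odd mulN1r opprK -exprM mulnC addrC polyC_exp.
Qed.

Lemma horner_hom_cofactor (a b : nat) (n t : int) :
  (hom_cofactor a b n).[t] = homsum a n (- t ^+ b).
Proof.
by have := rmorph_homsum (horner_eval t) a n%:P (- 'X^b); rewrite /= /horner_eval !hornerE.
Qed.

(** For [P = X^k + c], the combination [k P - X P'] is the nonzero constant [k c]. *)
Lemma separable_Xn_addC (k : nat) (c : algC) :
  (0 < k)%N -> c != 0 -> separable_poly ('X^k + c%:P).
Proof.
case: k => // k _ c0; rewrite unlock derivD derivC addr0 derivXn.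
apply/Bezout_coprimepP; exists (k.+1%:R%:P, - 'X) => /=.
rewrite mulrDr -polyCM mulNr mulrnAr -exprS polyC_natr mulr_natl addrAC subrr.
by rewrite add0r polyC_eqp1 mulf_neq0 // pnatr_eq0.
Qed.

Lemma map_ratr_intr (p : {poly int}) :
  map_poly ratr (map_poly (intr : int -> rat) p) = map_poly (intr : int -> algC) p.
Proof. by rewrite -map_poly_comp; apply: eq_map_poly => c /=; rewrite ratr_int. Qed.

(** Where [y^b = -n], the cofactor takes the nonzero value [a n^(a-1)], so the two factors share no
    root. *)
Lemma root_hom_cofactor (a b : nat) (n : int) (y : algC) : odd a -> n != 0 ->
  root (map_poly (intr : int -> algC) (hom_cofactor a b n)) y =
    (y ^+ b != - n%:~R) && (y ^+ (a * b) == - n%:~R ^+ a).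
Proof.
move=> a_odd n0; have a_gt0 : (0 < a)%N by case: (a) a_odd.
have : root (map_poly (intr : int -> algC) (('X^b + n%:P) * hom_cofactor a b n)) y =
       (y ^+ (a * b) == - n%:~R ^+ a).
  rewrite mul_hom_cofactor // rmorphD /= map_polyXn map_polyC rootE !hornerE.
  by rewrite addr_eq0 /= rmorphXn.
rewrite rmorphM rootM rmorphD /= map_polyXn map_polyC rootE !hornerE addr_eq0.
case: eqP => [Dy _ | _ /= <- //]; rewrite rmorph_homsum rmorphN /= map_polyXn map_polyC /=.
have := rmorph_homsum (horner_eval y) a n%:~R%:P (- 'X^b).
rewrite rootE /= /horner_eval => ->; rewrite !hornerE Dy opprK homsum_diag.
by rewrite mulf_eq0 pnatr_eq0 expf_eq0 intr_eq0 (negbTE n0) andbF orbF gtn_eqF.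
Qed.

Lemma perm_aut_roots (q : {poly rat}) (r : seq algC) (u : {rmorphism algC -> algC}) :
  uniq r -> (forall z, (z \in r) = root (map_poly ratr q) z) ->
  perm_eq (map u r) r.
Proof.
move=> r_uniq r_root; have u_inj := fmorph_inj u.
have sub_ur : {subset map u r <= r}.
  move=> _ /mapP[z r_z ->]; move: r_z; rewrite !r_root.
  rewrite -(fmorph_root u) -map_poly_comp; congr (is_true (root _ _)).
  by apply: eq_map_poly => c /=; rewrite fmorph_rat.
have ur_uniq : uniq (map u r) by rewrite map_inj_uniq.
have [|_ ur_r] := uniq_min_size ur_uniq sub_ur; first by rewrite size_map.
exact: uniq_perm.
Qed.

Definition pow_fiber (b : nat) (r : seq algC) (x : algC) :=
  [seq y <- r | y ^+ b == x ^+ b].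

Lemma perm_aut_fiber (b : nat) (r : seq algC) (u : {rmorphism algC -> algC}) (x : algC) :
  perm_eq (map u r) r -> perm_eq (map u (pow_fiber b r x)) (pow_fiber b r (u x)).
Proof.
move=> /(perm_filter (fun z => z ^+ b == u x ^+ b)); rewrite filter_map.
congr (perm_eq (map u _) _); apply: eq_filter => z /=.
by rewrite -!rmorphXn (inj_eq (fmorph_inj u)).
Qed.

(* With [t] the common modulus of the roots, the product [P x] of the fiber of
   [x] has [P x * P x^* = t ^ (2 * size (pow_fiber b r x))], which no automorphism
   changes, since automorphisms preserve the relation [x ^ b * y ^ b = t ^ (2 * b)]
   between the fibers of [x] and [y = x^*]. *)
Lemma Crat_exp_size_fiber (q : {poly rat}) (r : seq algC) (b : nat) (t x : algC) :
  uniq r -> (forall z, (z \in r) = root (map_poly ratr q) z) ->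
  t != 0 -> t ^+ b \in Crat -> (forall z, z \in r -> `|z| = t) -> x \in r ->
  t ^+ (2 * size (pow_fiber b r x)) \in Crat.
Proof.
move=> r_uniq r_root t0 tb r_t r_x.
have permr u := perm_aut_roots u r_uniq r_root.
pose P y := \prod_(z <- pow_fiber b r y) z.
have uP (u : {rmorphism algC -> algC}) y : u (P y) = P (u y).
  by rewrite /P rmorph_prod -(perm_big _ (perm_aut_fiber b y (permr u))) big_map.
have PE y z : y ^+ b = z ^+ b -> P y = P z by rewrite /P /pow_fiber => ->.
have normP y : y \in r -> P y * P y^* = t ^+ (2 * size (pow_fiber b r y)).
  move=> r_y; rewrite -(uP Num.conj) -normCK mulnC exprM normr_prod.
  congr (_ ^+ 2); rewrite (eq_big_seq (fun=> t)).
    by rewrite big_const_seq count_predT iter_mulr_1.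
  by move=> z; rewrite mem_filter => /andP[_ /r_t].
have bar y : y \in r -> (y^*) ^+ b = t ^+ b * t ^+ b / y ^+ b.
  move=> r_y; have y0 : y != 0 by rewrite -normr_gt0 r_t // lt0r t0 -(r_t _ r_y) normr_ge0.
  by rewrite -exprMn -expr2 -(r_t _ r_y) normCK exprMn [_ * (y^* ^+ b)]mulrC mulfK ?expf_neq0.
apply: aut_fixed_Crat => u; rewrite -normP // rmorphM !uP.
have r_ux : u x \in r by rewrite -(perm_mem (permr u)) map_f.
(* [u x^*] and [(u x)^*] may differ, but their [b]-th powers agree because [t ^+ b] is rational, and
   [P] depends only on the [b]-th power. *)
have -> : P (u x^*) = P (u x)^*.
  apply: PE; have := aut_Crat u tb; rewrite -rmorphXn !bar //.
  by move: (t ^+ b) => c uc; rewrite !rmorphM fmorphV rmorphXn uc.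
by rewrite !normP // -(perm_size (perm_aut_fiber b x (permr u))) size_map.
Qed.

(* If the fiber [y ^ b = x ^ b] of a root [x] of a rational factor contained only
   [e < b] roots of it, then [t ^ (2 e)] and [t ^ b = |n|] would be rational, so
   [|n|] would be a [b]-th power.  Hence fibers are full, and automorphisms acting
   on the [a]-th roots of unity reach all of them. *)
Lemma irreducible_hom_cofactor (a b : nat) (n : int) :
  prime a -> odd a -> prime b -> odd b -> (forall y : int, n <> y ^+ b) ->
  irreducible_poly (map_poly (intr : int -> rat) (hom_cofactor a b n)).
Proof.
move=> a_pr a_odd b_pr b_odd n_npow.
have [a_gt0 b_gt0] := (prime_gt0 a_pr, prime_gt0 b_pr).
have n0 : n != 0.
  by apply/eqP=> n0; apply: (n_npow 0); rewrite n0 expr0n gtn_eqF.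
have ab_gt0 : (0 < a * b)%N by rewrite muln_gt0 a_gt0.
set F := map_poly _ _.
pose FC : {poly algC} := map_poly (intr : int -> algC) (hom_cofactor a b n).
have DFC : map_poly ratr F = FC by apply: map_ratr_intr.
have root_F := root_hom_cofactor b _ a_odd n0; rewrite -/FC in root_F.
have FC_dvd : FC %| 'X^(a * b) + (n%:~R ^+ a)%:P.
  apply/dvdpP; exists ('X^b + (n%:~R)%:P).
  have := congr1 (map_poly (intr : int -> algC)) (mul_hom_cofactor b n a_odd).
  by rewrite rmorphM !rmorphD /= !map_polyXn !map_polyC /= rmorphXn.
have sep : separable_poly ('X^(a * b) + (n%:~R ^+ a)%:P : {poly algC}).
  by rewrite separable_Xn_addC // expf_neq0 // intr_eq0.
have FC_sep := dvdp_separable FC_dvd sep.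
have FC0 := separable_poly_neq0 FC_sep.
have F0 : F != 0 by rewrite -(map_poly_eq0 (ratr : {rmorphism rat -> algC})) DFC.
have szF : size F = (a.-1 * b).+1.
  have inj_intr : injective (intr : int -> rat) by apply: intr_inj.
  rewrite size_map_inj_poly //.
  have := congr1 (fun p : {poly int} => size p) (mul_hom_cofactor b n a_odd).
  have cof0 : hom_cofactor a b n != 0.
    by apply: contraNneq F0; rewrite /F => ->; rewrite rmorph0.
  rewrite size_mul ?size_XnaddC // -?size_poly_eq0 ?size_XnaddC //= => Dsz.
  by rewrite -[LHS](addKn b) Dsz -(prednK a_gt0) /= mulSn -addnS addKn.
split=> [|q sz_q dv_q].
  rewrite szF ltnS muln_gt0 b_gt0 andbT.
  by case: (a) a_pr => [|[]].
have q0 : q != 0 by apply: contraNneq F0 => q0; rewrite q0 dvd0p in dv_q.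
rewrite /eqp dv_q -(dvdp_map (ratr : {rmorphism rat -> algC})) DFC.
set qC := map_poly _ q; have qC_dvd : qC %| FC by rewrite -DFC dvdp_map.
have [r Dr] := closed_field_poly_normal qC.
have lq0 : lead_coef qC != 0 by rewrite lead_coef_eq0 map_poly_eq0.
have r_root z : (z \in r) = root qC z by rewrite Dr rootZ // root_prod_XsubC.
have r_uniq : uniq r.
  rewrite -separable_prod_XsubC -(eqp_separable (eqp_scale _ lq0)) -Dr.
  exact: dvdp_separable qC_dvd FC_sep.
have rF z : z \in r -> root FC z.
  by rewrite r_root; case/dvdpP: qC_dvd => g ->; rewrite rootM orbC => ->.
pose t : algC := b.-root (`|n|%:~R).
have t_ge0 : 0 <= t by rewrite rootC_ge0 // ler0z.
have Dt : t ^+ b = `|n|%:~R by rewrite rootCK.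
have t0 : t != 0 by rewrite rootC_eq0 // intr_eq0 normr_eq0.
have r_t z : z \in r -> `|z| = t.
  move=> /rF; rewrite root_F => /andP[_ /eqP Dz].
  apply: (pexpIrn ab_gt0); rewrite ?nnegrE // -normrX Dz normrN normrX mulnC exprM Dt.
  by rewrite intr_norm.
have fiber_all x z : x \in r -> z ^+ b = x ^+ b -> z \in r.
  move=> r_x Dz.
  have t_sz := Crat_exp_size_fiber r_uniq r_root t0 _ r_t r_x.
  have {t_sz}t_sz : t ^+ (2 * size (pow_fiber b r x)) \in Crat.
    by apply: t_sz; rewrite Dt rpred_int.
  have fib_gt0 : (0 < size (pow_fiber b r x))%N.
    by rewrite size_filter -has_count; apply/hasP; exists x => /=.
  have b_le : (b <= size (pow_fiber b r x))%N.
    rewrite leqNgt; apply/negP=> lt_b.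
    have co : gcdn (2 * size (pow_fiber b r x)) b = 1%N.
      apply/eqP; rewrite -/(coprime _ _) coprime_sym prime_coprime // Euclid_dvdM //.
      rewrite [(b %| size _)%N]gtnNdvd // orbF; apply: contraL b_odd.
      by rewrite dvdn_prime2 // => /eqP ->.
    have := Crat_exp_gcd t0 _ t_sz (_ : t ^+ b \in Crat).
    rewrite co expr1 Dt rpred_int muln_gt0 fib_gt0 => /(_ isT isT) t_rat.
    by have [y /n_npow] := int_root_of_rat_norm b_odd t_rat Dt.
  (* A missing [z] would add one more root to the at least [b] elements of the fiber, too many for
     [X^b - x^b]. *)
  apply: contraTT b_le => r'z; rewrite -ltnNge.
  have sz : size ('X^b - (x ^+ b)%:P) = b.+1 by rewrite size_XnsubC.
  rewrite -ltnS -[X in (_ < X)%N]sz.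
  apply: (@max_poly_roots _ _ (z :: pow_fiber b r x)).
  - by rewrite -size_poly_eq0 sz.
  - rewrite /= !rootE !hornerE Dz subrr eqxx /=.
    apply/allP=> y; rewrite mem_filter => /andP[/eqP Dy _].
    by rewrite rootE !hornerE Dy subrr.
  - by rewrite /= mem_filter negb_and r'z orbT filter_uniq.
have [x r_x] : exists x, x \in r.
  have : size qC != 1%N by rewrite size_map_poly.
  rewrite Dr size_scale // size_prod_XsubC.
  by case: (r) => [|x r'] // _; exists x; rewrite mem_head.
have all_r y : root FC y -> y \in r.
  rewrite root_F => /andP[y_n /eqP Dy].
  have := rF _ r_x; rewrite root_F => /andP[x_n /eqP Dx].
  (* As [a] is prime, the roots of the cofactor are the [z] for which [-z^b / n] is a primitive
     [a]-th root of unity. An automorphism carrying [zeta x] to [zeta y] sends [x] into the fiber of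
     [y]. *)
  pose zeta z : algC := - z ^+ b / n%:~R.
  have nC0 : n%:~R != 0 :> algC by rewrite intr_eq0.
  have zeta_prim z : z ^+ b != - n%:~R -> z ^+ (a * b) = - n%:~R ^+ a ->
      a.-primitive_root (zeta z).
    move=> z_n Dz; have : zeta z ^+ a = 1.
      rewrite expr_div_n exprNn -signr_odd a_odd mulN1r -exprM mulnC Dz opprK.
      by rewrite divff // expf_neq0.
    case/(prim_order_exists a_gt0)=> m prim_m /(primeP a_pr).2/pred2P[] Dm.
      case/eqP: z_n; have := prim_expr_order prim_m; rewrite Dm expr1.
      by move/divr1_eq <-; rewrite opprK.
    by rewrite -Dm.
  have zE z : z ^+ b = - (zeta z * n%:~R) by rewrite /zeta divfK // opprK.
  have [k Dk] := prim_rootP (zeta_prim x x_n Dx) (prim_expr_order (zeta_prim y y_n Dy)).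
  have := zeta_prim y y_n Dy; rewrite Dk prim_root_exp_coprime; last exact: zeta_prim.
  case/Qn_aut_exists=> u Du.
  apply: (fiber_all (u x)).
    by rewrite -(perm_mem (perm_aut_roots u r_uniq r_root)) map_f.
  rewrite -rmorphXn !zE rmorphN rmorphM rmorph_int Du ?Dk //.
  exact/prim_expr_order/zeta_prim.
have [s Ds] := closed_field_poly_normal FC.
rewrite Ds dvdpZl ?lead_coef_eq0 //.
apply: uniq_roots_dvdp.
  apply/allP=> y s_y; rewrite -r_root; apply: all_r.
  by rewrite Ds rootZ ?lead_coef_eq0 // root_prod_XsubC.
rewrite uniq_rootsE -separable_prod_XsubC.
by rewrite -(eqp_separable (eqp_scale _ (_ : lead_coef FC != 0))) -?Ds ?lead_coef_eq0.
Qed.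

(** * Specialization under hypothesis (H) *)

Lemma Euclid_dvdzM (p : nat) (m n : int) : prime p ->
  (p %| m * n)%Z = (p %| m)%Z || (p %| n)%Z.
Proof. by move=> p_pr; rewrite !dvdzE abszM Euclid_dvdM. Qed.

Lemma Euclid_dvdz_prod (p : nat) (T : eqType) (s : seq T) (F : T -> int) : prime p ->
  reflect (exists2 x, x \in s & (p %| F x)%Z) (p %| \prod_(x <- s) F x)%Z.
Proof.
move=> p_pr; apply: (iffP idP) => [|[x s_x dv_x]]; last first.
  by rewrite (big_rem x) //= dvdz_mulr.
elim: s => [|x s IHs]; first by rewrite big_nil dvdz1 absz_nat gtn_eqF ?prime_gt1.
rewrite big_cons Euclid_dvdzM // => /orP[dv_x | /IHs[y s_y dv_y]].
  by exists x; rewrite ?mem_head.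
by exists y; rewrite ?in_cons ?s_y ?orbT.
Qed.

Lemma dvdz_horner_sub (f : {poly int}) (x y : int) : (x - y %| f.[x] - f.[y])%Z.
Proof.
have /factor_theorem[q Dq] : root (f - f.[y]%:P) y by rewrite rootE !hornerE subrr.
have := congr1 (fun g => g.[x]) Dq; rewrite !hornerE => ->.
exact: dvdz_mull.
Qed.

Lemma eqz_mod_dvdl (d e m n : int) :
  (d %| e)%Z -> (m = n %[mod e])%Z -> (m = n %[mod d])%Z.
Proof.
move=> d_e /eqP mn; apply/eqP; move: mn; rewrite !eqz_mod_dvd.
exact: dvdz_trans.
Qed.

Lemma tends_to_pinfty_lead_coef (f : {poly int}) :
  0 < lead_coef f -> (1 < size f)%N -> tends_to_pinfty f.
Proof.
have step (g : {poly int}) (c M : int) : (exists N : int, forall x, N <= x -> 1 <= g.[x]) ->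
    exists N : int, forall x, N <= x -> M <= (g * 'X + c%:P).[x].
  case=> N gN; exists (`|N| + `|M| + `|c|) => x le_x; rewrite !hornerE.
  have /gN : N <= x by lia.
  have x_ge : `|M| + `|c| <= x by lia.
  move: (g.[x]) x_ge => y x_ge y_ge1; have : x <= y * x by apply: ler_peMl => //; lia.
  lia.
(* Constants do not tend to infinity, so the induction also carries the bound [1 <= f.[x]] for large
   [x], which is all that [step] requires of [g]. *)
suff : 0 < lead_coef f -> (exists N : int, forall x, N <= x -> 1 <= f.[x]) /\
         ((1 < size f)%N -> tends_to_pinfty f).
  by move=> tends /tends[].
elim/poly_ind: f => [|f c IHf]; first by rewrite lead_coef0.
have [-> | f0] := eqVneq f 0.
  rewrite mul0r add0r lead_coefC => c_gt0; split=> [|]; last first.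
    by rewrite size_polyC; case: (c != 0).
  by exists 0 => x _; rewrite hornerC.
have sz : (1 < size (f * 'X)%R)%N by rewrite size_mulX // ltnS lt0n size_poly_eq0.
rewrite lead_coefDl ?lead_coefMX; last first.
  by rewrite (leq_ltn_trans (size_polyC_leq1 c)).
move=> /IHf[/step f_tends _]; split=> [|_ M]; exact: f_tends.
Qed.

(** The substitution of [k X + t] is undone by that of [L'], and both preserve degree and
    divisibility. *)
Lemma irreducible_affine (F : fieldType) (f g : {poly F}) (c k t : F) :
  c != 0 -> k != 0 -> c *: g = f \Po (k *: 'X + t%:P) ->
  irreducible_poly f -> irreducible_poly g.
Proof.
move=> c0 k0 Dg [sz_f irr_f].
have sz_lin (u v : F) : u != 0 -> size (u *: 'X + v%:P) = 2.
  move=> u0; rewrite size_polyDl size_scale // ?size_polyX //.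
  by rewrite (leq_ltn_trans (size_polyC_leq1 v)).
pose L' := k^-1 *: 'X + (- t / k)%:P.
have L'K : (k *: 'X + t%:P) \Po L' = 'X.
  rewrite comp_polyD comp_polyZ comp_polyX comp_polyC /L' scalerDr scalerA mulfV //.
  by rewrite scale1r -addrA -mul_polyC -polyCM mulrC divfK // -polyCD addNr addr0.
have LK : L' \Po (k *: 'X + t%:P) = 'X.
  rewrite comp_polyD comp_polyZ comp_polyX comp_polyC scalerDr scalerA mulVf //.
  by rewrite scale1r -addrA -mul_polyC -polyCM -polyCD mulNr [k^-1 * t]mulrC subrr addr0.
split=> [|q sz_q dv_q].
  by rewrite -(size_scale g c0) Dg size_comp_poly2 ?sz_lin.
have Df : f = (c *: g) \Po L' by rewrite Dg -comp_polyA L'K comp_polyXr.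
have : q \Po L' %= f.
  apply: irr_f; first by rewrite size_comp_poly2 ?sz_lin ?invr_eq0.
  by rewrite Df dvdp_comp_poly // dvdpZr.
case/andP=> _ /(dvdp_comp_poly (k *: 'X + t%:P)).
by rewrite -comp_polyA LK comp_polyXr -Dg dvdpZl // /eqp dv_q.
Qed.

(* This is [fd.1(N u + t0) / fd.2]; the division is exact only when [fd.2] divides
   [N] and [fd.1(t0)]. *)
Definition twist (N t0 : int) (fd : {poly int} * nat) : {poly int} :=
  map_poly (fun c => (c %/ fd.2%:Z)%Z) (fd.1 \Po (N *: 'X + t0%:P)).

(** Writing [f = f(t0) + (X - t0) h] gives [f(N u + t0) = d (w + M u h(N u + t0))], so the division
    is exact and the values of [g] are [w] modulo [M]. *)
Lemma twistE (f : {poly int}) (d : nat) (N M t0 w : int) :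
  (0 < d)%N -> N = d%:Z * M -> f.[t0] = d%:Z * w ->
  let g := twist N t0 (f, d) in
  d%:Z *: g = f \Po (N *: 'X + t0%:P) /\ forall x, (g.[x] = w %[mod M])%Z.
Proof.
move=> d_gt0 DN Dw g.
have /factor_theorem[h Dh] : root (f - f.[t0]%:P) t0 by rewrite rootE !hornerE subrr.
have d0 : d%:Z != 0 by rewrite -lt0n.
have Dcomp : f \Po (N *: 'X + t0%:P) =
    d%:Z *: (w%:P + M *: ((h \Po (N *: 'X + t0%:P)) * 'X)).
  rewrite -[f in LHS](subrK f.[t0]%:P) Dh comp_polyD comp_polyM comp_polyB comp_polyX.
  rewrite !comp_polyC addrK Dw polyCM DN scalerDr scalerA addrC -!mul_polyC.
  by congr (_ + _); rewrite mulrCA mulrC.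
have Dg : g = w%:P + M *: ((h \Po (N *: 'X + t0%:P)) * 'X).
  apply/polyP=> i; rewrite coef_map_id0 ?div0z //= Dcomp coefZ mulKz //.
split=> [|x]; first by rewrite Dcomp Dg.
apply/eqP; rewrite eqz_mod_dvd Dg !hornerE addrAC subrr add0r.
by do 2!apply: dvdz_mulr.
Qed.

(** Hypothesis (H) is applied to the twists. No prime [p] divides all products of their values: if
    [p] divides [K], each value is congruent modulo [p] to some [w] coprime to [K]; otherwise the
    progression [t0 + N u] meets every class modulo [p], including that of a non-root. *)
Lemma SchinzelH_twisted (fds : seq ({poly int} * nat)) (t0 : int) (K E : nat) :
  SchinzelH -> (2 %| K)%N -> (0 < K)%N ->
  (forall fd, fd \in fds ->
     irreducible_poly (map_poly (intr : int -> rat) fd.1) /\ 0 < lead_coef fd.1) ->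
  (forall fd, fd \in fds -> exists M w : int,
     [/\ (K ^ E)%N%:Z = fd.2%:Z * M, ((K ^ 2)%N%:Z %| M)%Z, fd.1.[t0] = fd.2%:Z * w,
         coprimez w K & (w = 1 %[mod 4])%Z]) ->
  (forall p, prime p -> ~~ (p %| K)%N ->
     exists t : int, ~~ (p %| \prod_(fd <- fds) fd.1.[t])%Z) ->
  exists t : int, forall fd, fd \in fds ->
    exists q, [/\ prime q, q = 1 %[mod 4] & fd.1.[t] = fd.2%:Z * q%:Z].
Proof.
move=> H K2 K_gt0 irr loc nonroot; pose N := (K ^ E)%N%:Z.
have N0 : N != 0 by rewrite -lt0n expn_gt0 K_gt0.
have d_gt0 fd : fd \in fds -> (0 < fd.2)%N.
  move=> /loc[M [w [DN _ _ _ _]]]; rewrite lt0n.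
  by apply: contraNneq N0; rewrite /N DN => ->; rewrite mul0r.
pose gs := [seq twist N t0 fd | fd <- fds].
have twistP fd : fd \in fds -> exists w : int,
    [/\ fd.2%:Z *: twist N t0 fd = fd.1 \Po (N *: 'X + t0%:P),
        coprimez w K, (w = 1 %[mod 4])%Z
      & forall x, ((twist N t0 fd).[x] = w %[mod (K ^ 2)%N%:Z])%Z].
  case: fd => f d fds_fd; have [M [w [DN K2_M Dw co_w w1]]] := loc _ fds_fd.
  have [Dg g_w] := twistE (d_gt0 _ fds_fd) DN Dw.
  by exists w; split=> // x; apply: eqz_mod_dvdl K2_M (g_w x).
have hornerL fd x : fd \in fds ->
    fd.1.[t0 + N * x] = fd.2%:Z * (twist N t0 fd).[x].
  by move=> /twistP[w [Dg _ _ _]]; rewrite -hornerZ Dg horner_comp !hornerE addrC.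
have sz_L : size (N *: 'X + t0%:P) = 2.
  rewrite size_polyDl size_scale // ?size_polyX //.
  by rewrite (leq_ltn_trans (size_polyC_leq1 t0)).
have lead_L : lead_coef (N *: 'X + t0%:P) = N.
  rewrite lead_coefDl ?lead_coefZ ?lead_coefX ?mulr1 // size_scale // size_polyX.
  by rewrite (leq_ltn_trans (size_polyC_leq1 t0)).
have [|||x gx] := H gs.
- move=> _ /mapP[fd fds_fd ->]; have [w [Dg _ _ _]] := twistP _ fds_fd.
  have [irr_f _] := irr _ fds_fd.
  apply: (@irreducible_affine rat _ _ fd.2%:R N%:~R t0%:~R _ _ _ irr_f).
  + by rewrite pnatr_eq0 -lt0n d_gt0.
  + by rewrite intr_eq0.
  + have := congr1 (map_poly (intr : int -> rat)) Dg.
    by rewrite map_polyZ map_comp_poly rmorphD /= map_polyZ map_polyX map_polyC.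
- move=> d d_dvd; apply/eqP/negPn/negP=> d1.
  have [p p_pr p_d] : exists2 p, prime p & (p %| d)%Z.
    case: (ltngtP `|d|%N 1%N) d1 => // [|d_gt1 _].
      rewrite ltnS leqn0 absz_eq0 => /eqP -> _; by exists 2%N.
    by exists (pdiv `|d|%N); rewrite ?pdiv_prime // dvdzE pdiv_dvd.
  have p_gs y : exists2 fd, fd \in fds & (p %| (twist N t0 fd).[y])%Z.
    have := dvdz_trans p_d (d_dvd y); rewrite big_map.
    by move/(Euclid_dvdz_prod _ _ p_pr).
  have [p_K | p'K] := boolP (p %| K)%N.
    have [fd fds_fd p_fd] := p_gs 0.
    have [w [_ co_w _ /(_ 0) g_w]] := twistP _ fds_fd.
    have p_w : (p %| w)%Z.
      have p_K2 : (p%:Z %| (K ^ 2)%N%:Z)%Z by rewrite dvdzE /= dvdn_exp.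
      have /eqP := eqz_mod_dvdl p_K2 g_w; rewrite eqz_mod_dvd => p_gw.
      by rewrite -[w](subKr (twist N t0 fd).[0]) rpredB.
    have : (p %| gcdz w K)%Z by rewrite dvdz_gcd p_w.
    by rewrite (eqP co_w) dvdz1 absz_nat gtn_eqF ?prime_gt1.
  have [t /negP p't] := nonroot p p_pr p'K; apply: p't.
  have co_pN : coprimez N p.
    by rewrite coprimezE !absz_nat coprimeXl // coprime_sym prime_coprime.
  have /coprimezP[[u v] /= Duv] := co_pN.
  (* [u] inverts [N] modulo [p], so [t0 + N y = t] modulo [p]. *)
  pose y := u * (t - t0).
  have [fd fds_fd p_fd] := p_gs y; apply/(Euclid_dvdz_prod _ _ p_pr); exists fd => //.
  have Dt : t0 + N * y - t = - (v * p%:Z * (t - t0)).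
    have -> : v * p%:Z = 1 - u * N by rewrite -Duv addrC addKr.
    by rewrite /y; ring.
  have p_fB : (p %| fd.1.[t0 + N * y] - fd.1.[t])%Z.
    by apply: dvdz_trans (dvdz_horner_sub _ _ _); rewrite Dt rpredN mulrAC dvdz_mull.
  rewrite -[X in (_ %| X)%Z](subKr fd.1.[t0 + N * y]) rpredB //.
  by rewrite hornerL // dvdz_mull.
- move=> _ /mapP[fd fds_fd ->]; have [w [Dg _ _ _]] := twistP _ fds_fd.
  have [[sz_f _] lead_f] := irr _ fds_fd; have d_fd := d_gt0 _ fds_fd.
  apply: tends_to_pinfty_lead_coef.
    rewrite -(pmulr_rgt0 _ (_ : 0 < fd.2%:Z)) // -lead_coefZ Dg lead_coef_comp ?sz_L //.
    by rewrite lead_L mulr_gt0 // exprn_gt0 // lt0r N0.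
  rewrite -(size_scale _ (_ : fd.2%:Z != 0)) -?lt0n // Dg size_comp_poly2 //.
  by rewrite size_map_inj_poly in sz_f; [ | exact: intr_inj | ].
exists (t0 + N * x) => fd fds_fd; rewrite hornerL //.
have [q [q_pr Dq]] := gx _ (map_f _ fds_fd).
exists q; rewrite Dq; split=> //.
have [w [_ _ w1 /(_ x) g_w]] := twistP _ fds_fd.
(* [K] is even, so residues modulo [K^2] determine residues modulo 4. *)
have d4 : (4 %| (K ^ 2)%N%:Z)%Z by exact: (@dvdn_exp2r 2 K 2 K2).
have := eqz_mod_dvdl d4 g_w; rewrite w1 Dq (modz_nat q 4) (modz_nat 1 4).
by case.
Qed.

(** * Sufficiency *)

Lemma sum2sqX (m : int) (e : nat) : sum2sq m -> sum2sq (m ^+ e).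
Proof.
move=> m_sum; elim: e => [|e IHe]; first by exists 1, 0.
by rewrite exprS; apply: sum2sqM.
Qed.

Lemma sum2sq_pow2 (e : nat) : sum2sq (2 ^+ e).
Proof. by apply: sum2sqX; exists 1, 1. Qed.

(* No further local condition is needed: modulo a prime outside [K], one of
   [t = 0] and [t = 1] is not a root of ['X^k + m]. *)
Lemma sum2sq_of_factors (fds : seq ({poly int} * nat)) (t0 m : int) (k K E : nat) :
  SchinzelH -> odd k -> (2 %| K)%N -> (0 < K)%N ->
  \prod_(fd <- fds) fd.1 = 'X^k + m%:P ->
  sum2sq (\prod_(fd <- fds) fd.2%:Z) ->
  (forall fd, fd \in fds ->
     irreducible_poly (map_poly (intr : int -> rat) fd.1) /\ 0 < lead_coef fd.1) ->
  (forall fd, fd \in fds -> exists (e : nat) (w : int),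
     [/\ (fd.2 %| K ^ e)%N, (e + 2 <= E)%N, fd.1.[t0] = fd.2%:Z * w,
         coprimez w K & (w = 1 %[mod 4])%Z]) ->
  exists z : int, sum2sq (m - z ^+ k).
Proof.
move=> H k_odd K2 K_gt0 Df d_sum irr loc.
have f_t t : \prod_(fd <- fds) fd.1.[t] = t ^+ k + m.
  by rewrite -horner_prod Df !hornerE.
have [|p p_pr _|t ft] := SchinzelH_twisted (t0 := t0) (E := E) H K2 K_gt0 irr.
- move=> fd /loc[e [w [/dvdnP[c Dc] le_eE Dw co_w w1]]].
  (* This witness is divisible by [K^2] because [e + 2 <= E]. *)
  exists (c * K ^ (E - e))%N, w; split=> //.
    rewrite -PoszM mulnA [(_ * c)%N]mulnC -Dc -expnD subnKC //.
    by rewrite (leq_trans _ le_eE) ?leq_addr.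
  by rewrite dvdzE /= dvdn_mull // dvdn_exp2l // leq_subRL ?(leq_trans _ le_eE) ?leq_addr.
- have [p_m | p'm] := boolP (p %| m)%Z; [exists 1 | exists 0]; rewrite f_t.
    by rewrite expr1n rpredDr // dvdz1 absz_nat gtn_eqF ?prime_gt1.
  by rewrite expr0n; case: (k) k_odd => // ? _; rewrite add0r.
exists (- t); rewrite exprNn -signr_odd k_odd mulN1r opprK addrC -f_t.
suff [Q Q_sum ->] : exists2 Q, sum2sq Q &
    \prod_(fd <- fds) fd.1.[t] = \prod_(fd <- fds) fd.2%:Z * Q by apply: sum2sqM.
elim: {Df d_sum irr loc f_t} fds ft => [_|fd s IHs ft].
  by exists 1; [exists 1, 0 | rewrite !big_nil].
have [|Q Q_sum DQ] := IHs; first by move=> fd' s_fd'; apply: ft; rewrite in_cons s_fd' orbT.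
have [q [q_pr q1 Dq]] := ft fd (mem_head _ _).
exists (q%:Z * Q); first by apply: sum2sqM => //; apply: sum2sq_prime.
by rewrite !big_cons DQ Dq; ring.
Qed.

Lemma lead_coef_XnaddC_gt0 (k : nat) (c : int) : (0 < k)%N ->
  0 < lead_coef ('X^k + c%:P).
Proof. by move=> k_gt0; rewrite (monicP (monicXnaddC c k_gt0)). Qed.

Lemma lead_coef_hom_cofactor_gt0 (a b : nat) (n : int) : odd a -> (0 < b)%N ->
  0 < lead_coef (hom_cofactor a b n).
Proof.
move=> a_odd b_gt0; have a_gt0 : (0 < a)%N by case: (a) a_odd.
have := congr1 (@lead_coef _) (mul_hom_cofactor b n a_odd).
rewrite lead_coefM (monicP (monicXnaddC n b_gt0)) mul1r => ->.
by rewrite lead_coef_XnaddC_gt0 // muln_gt0 a_gt0.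
Qed.

Lemma coprimez_pow2 (w : int) (e : nat) : (w %% 2 = 1)%Z -> coprimez w (2 ^ e)%N.
Proof.
move=> w_odd; rewrite coprimezE absz_nat coprimeXr // coprimen2.
by move: w_odd; clear; lia.
Qed.

Lemma sum2sq_irreducible (m : int) (k : nat) : SchinzelH -> odd k ->
  irreducible_poly (map_poly (intr : int -> rat) ('X^k + m%:P)) ->
  exists z : int, sum2sq (m - z ^+ k).
Proof.
move=> H k_odd irr; have k_gt0 : (0 < k)%N by case: (k) k_odd.
(* With [c] making [t0 = c - m] odd, [t0^k + m = c] modulo 8, so division by [c], which is 1 or 2,
   leaves a number [1 mod 4]. *)
have [c c12 cm_odd] : exists2 c : nat, (c == 1%N) || (c == 2%N) & ((c%:Z - m) %% 2 = 1)%Z.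
  by have [m0 | m1] : (m %% 2 = 0)%Z \/ (m %% 2 = 1)%Z; [lia | exists 1%N | exists 2%N]; lia.
apply: (@sum2sq_of_factors [:: ('X^k + m%:P, c)] (c%:Z - m) m k 2 3) => //.
- by rewrite big_seq1.
- by rewrite big_seq1; case/orP: c12 => /eqP ->; [exists 1, 0 | exists 1, 1].
- by move=> fd; rewrite inE => /eqP -> /=; rewrite lead_coef_XnaddC_gt0.
move=> fd; rewrite inE => /eqP -> /=; rewrite !hornerE.
have := exp_odd_mod8 k_odd cm_odd; move: (_ ^+ k) => u Du.
exists 1%N, ((u + m) %/ c%:Z)%Z; split=> //.
- by case/orP: c12 => /eqP ->.
- by case/orP: c12 Du => /eqP ->; clear; lia.
- by rewrite (coprimez_pow2 1) //; case/orP: c12 Du => /eqP ->; clear; lia.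
- by case/orP: c12 Du => /eqP ->; clear; lia.
Qed.

Lemma sum2sq_factored (a b : nat) (n t0 w1 w2 : int) (d1 d2 K E : nat) :
  SchinzelH -> prime a -> odd a -> prime b -> odd b -> (forall y : int, n <> y ^+ b) ->
  (2 %| K)%N -> (0 < K)%N -> sum2sq (d1%:Z * d2%:Z) ->
  (d1 %| K ^ E)%N -> (d2 %| K ^ E)%N ->
  n + t0 ^+ b = d1%:Z * w1 -> homsum a n (- t0 ^+ b) = d2%:Z * w2 ->
  coprimez w1 K -> coprimez w2 K -> (w1 = 1 %[mod 4])%Z -> (w2 = 1 %[mod 4])%Z ->
  exists z : int, sum2sq (n ^+ a - z ^+ (a * b)).
Proof.
move=> H a_pr a_odd b_pr b_odd n_npow K2 K_gt0 d_sum d1_K d2_K Dw1 Dw2 co1 co2 w11 w21.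
have b_gt0 := prime_gt0 b_pr.
have irr1 : irreducible_poly (map_poly (intr : int -> rat) ('X^b + n%:P)).
  apply: irreducible_Xn_addC (prime_gt1 b_pr) _ => // p p_pr.
  by rewrite dvdn_prime2 // => /eqP ->.
pose fds := [:: ('X^b + n%:P, d1); (hom_cofactor a b n, d2)].
apply: (@sum2sq_of_factors fds t0 _ _ K (E + 2)) => //.
- by rewrite oddM a_odd.
- by rewrite big_cons big_seq1 /= mul_hom_cofactor.
- by rewrite big_cons big_seq1.
- move=> fd; rewrite !inE => /orP[] /eqP -> /=; split=> //.
  + exact: lead_coef_XnaddC_gt0.
  + exact: irreducible_hom_cofactor.
  + exact: lead_coef_hom_cofactor_gt0.
move=> fd; rewrite !inE => /orP[] /eqP -> /=; exists E.
  by exists w1; rewrite !hornerE addrC.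
by exists w2; rewrite horner_hom_cofactor.
Qed.

Lemma exp_even_mod4 (z : int) (e : nat) : ~~ odd e -> (z %% 2 = 1)%Z ->
  (z ^+ e = 1 %[mod 4])%Z.
Proof.
move=> e_even z_odd; rewrite -(even_halfK e_even) -muln2 mulnC exprM -modzXm.
have -> : (z ^+ 2 %% 4 = 1)%Z; last by rewrite expr1n.
have [q ->] : exists q, z = 2 * q + 1 by exists (z %/ 2)%Z; clear -z_odd; lia.
by rewrite (_ : _ ^+ 2 = (q ^+ 2 + q) * 4 + 1) ?modzMDl //; ring.
Qed.

Lemma modz4_cancel (u v : int) : (u = 1 %[mod 4])%Z -> (u * v = 1 %[mod 4])%Z ->
  (v = 1 %[mod 4])%Z.
Proof. by move=> u1; rewrite -modzMml u1 modzMml mul1r. Qed.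

Lemma sum2sq_not_6mod8 (a b : nat) (n : int) :
  SchinzelH -> prime a -> prime b -> a = 1 %[mod 4] -> b = 1 %[mod 4] ->
  (forall y : int, n <> y ^+ b) -> (n %% 8)%Z <> 6 ->
  exists z : int, sum2sq (n ^+ a - z ^+ (a * b)).
Proof.
move=> H a_pr b_pr a1 b1 n_npow n6.
have [a_odd b_odd] := (prime_1mod4_odd a1, prime_1mod4_odd b1).
have [a_gt0 b_gt0] := (prime_gt0 a_pr, prime_gt0 b_pr).
have a'_even : ~~ odd (a - 1) by clear -a_odd a_gt0; lia.
have ab_odd : odd (a * b) by rewrite oddM a_odd.
have mulE (t : int) : (n + t ^+ b) * homsum a n (- t ^+ b) = n ^+ a + t ^+ (a * b).
  by rewrite -[X in n + X]opprK mul_homsum exprNn -signr_odd a_odd mulN1r opprK -exprM mulnC.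
have use t0 w1 w2 e1 e2 := @sum2sq_factored a b n t0 w1 w2 (2 ^ e1) (2 ^ e2) 2 (e1 + e2)
  H a_pr a_odd b_pr b_odd n_npow isT isT.
have {}use t0 w1 w2 e1 e2 : n + t0 ^+ b = 2 ^+ e1 * w1 ->
    homsum a n (- t0 ^+ b) = 2 ^+ e2 * w2 ->
    (w1 = 1 %[mod 4])%Z -> (w2 = 1 %[mod 4])%Z ->
    exists z : int, sum2sq (n ^+ a - z ^+ (a * b)).
  have pow2 e : (2 ^ e)%N%:Z = 2 ^+ e by rewrite -natz natrX.
  move=> Dw1 Dw2 w11 w21; apply: (use t0 w1 w2 e1 e2); rewrite ?pow2 -?exprD //.
  - exact: sum2sq_pow2.
  - by rewrite dvdn_exp2l ?leq_addr.
  - by rewrite dvdn_exp2l ?leq_addl.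
  - by rewrite (coprimez_pow2 1) //; clear -w11; lia.
  - by rewrite (coprimez_pow2 1) //; clear -w21; lia.
have hom0 : homsum a n (- 0 ^+ b) = n ^+ (a - 1).
  by rewrite expr0n gtn_eqF // oppr0 homsumx0.
have {}hom0 : n + 0 ^+ b = n /\ homsum a n (- 0 ^+ b) = n ^+ (a - 1).
  by rewrite hom0 expr0n gtn_eqF // addr0.
case: hom0 => n_0 hom0.
(* In order, [t0] is 0, [2 - n], 1 and 0. At 0 the factors are [n] and [n^(a-1)]. At [2 - n] the
   first factor is 2 modulo 8, at 1 it is 1 modulo 4, and the residue of the product
   [n^a + t0^(a b)] then settles the second factor. *)
have [n1 | [n3 | [n0 | n2]]] :
  (n %% 4 = 1)%Z \/ (n %% 4 = 3)%Z \/ (n %% 4 = 0)%Z \/ (n %% 8 = 2)%Z.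
- by clear -n6; lia.
- apply: (use 0 n (n ^+ (a - 1)) 0%N 0%N); rewrite ?n_0 ?hom0 ?mul1r //.
  by apply: exp_even_mod4 => //; clear -n1; lia.
- have t_odd : ((2 - n) %% 2 = 1)%Z by clear -n3; lia.
  have tb := exp_odd_mod8 b_odd t_odd; have tab := exp_odd_mod8 ab_odd t_odd.
  have na : (n ^+ a = n %[mod 8])%Z by apply: exp_odd_mod8 => //; clear -n3; lia.
  pose w1 := ((n + (2 - n) ^+ b) %/ 2)%Z.
  have Dw1 : n + (2 - n) ^+ b = 2 * w1 by rewrite /w1; move: (_ ^+ b) tb => u; clear; lia.
  have w11 : (w1 = 1 %[mod 4])%Z by move: Dw1 tb; move: (_ ^+ b) => u; clear; lia.
  apply: (use (2 - n) w1 (homsum a n (- (2 - n) ^+ b)) 1%N 0%N); rewrite ?expr0 ?mul1r //.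
  apply: modz4_cancel w11 _; have := mulE (2 - n); rewrite Dw1 -mulrA.
  by move: tab na; move: (_ * homsum _ _ _) (n ^+ a) (_ ^+ (a * b)) => u v w; clear; lia.
- have w11 : ((n + 1) = 1 %[mod 4])%Z by clear -n0; lia.
  have na : (n ^+ a %% 4 = 0)%Z.
    have [q ->] : exists q, n = 4 * q by exists (n %/ 4)%Z; clear -n0; lia.
    by rewrite -(prednK a_gt0) exprS -mulrA modzMr.
  apply: (use 1 (n + 1) (homsum a n (- 1 ^+ b)) 0%N 0%N); rewrite ?expr0 ?mul1r ?expr1n //.
  apply: modz4_cancel w11 _; have := mulE 1; rewrite !expr1n => ->.
  by move: na; move: (n ^+ a) => u; clear; lia.
- have [Dn n'1] : n = 2 * (n %/ 2)%Z /\ ((n %/ 2)%Z = 1 %[mod 4])%Z by clear -n2; lia.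
  apply: (use 0 (n %/ 2)%Z ((n %/ 2)%Z ^+ (a - 1)) 1%N (a - 1)%N); rewrite ?n_0 ?hom0 //.
    by rewrite -exprMn -Dn.
  by apply: exp_even_mod4 => //; move: (n %/ 2)%Z n'1 => u; clear; lia.
Qed.

(* Hensel's idea: if [s] lifts [z mod p], then the values at [s] and [s + 4 p] are
   not both divisible by [p ^ 2], because the derivative [a b z ^ (a b - 1)] of
   [z ^ (a b)] is a unit modulo [p]. *)
Lemma exists_simple_homsum (p a b : nat) (r z : int) :
  prime p -> odd p -> (0 < a)%N -> ~~ (p %| a)%N -> (0 < b)%N -> ~~ (p %| b)%N ->
  ~~ (p %| r)%Z -> (p %| homsum a r (z ^+ b))%Z ->
  exists s : int, [/\ (s = 1 %[mod 4])%Z, (p %| homsum a r (s ^+ b))%Z &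
    ~~ (p%:Z ^+ 2 %| homsum a r (s ^+ b))%Z].
Proof.
move=> p_pr p_odd a_gt0 p'a b_gt0 p'b p'r p_z; have p_gt0 := prime_gt0 p_pr.
have p0 : p%:Z != 0 by rewrite -lt0n.
have co4p : coprimez 4 p.
  by have : coprime (2 ^ 2) p by rewrite coprimeXl // coprime2n.
have hom_mod (s : int) : (s = z %[mod p])%Z -> (p %| homsum a r (s ^+ b))%Z.
  move/eqP; rewrite eqz_mod_dvd -!intr_Fp_eq0 // rmorphB subr_eq0 => /eqP Ds.
  by move: p_z; rewrite -intr_Fp_eq0 //; rewrite !rmorph_homsum !rmorphXn /= Ds.
pose s := zchinese 4 p 1 z.
have s1 : (s = 1 %[mod 4])%Z by apply: zchinese_modl.
have sz : (s = z %[mod p])%Z by apply: zchinese_modr.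
have p_s := hom_mod s sz.
have p's : ~~ (p %| s)%Z.
  apply/negP=> p_s0; have := p_s; rewrite -intr_Fp_eq0 // rmorph_homsum rmorphXn /=.
  move: p_s0; rewrite -intr_Fp_eq0 // => /eqP ->; rewrite expr0n gtn_eqF //.
  by rewrite homsumx0 // expf_eq0 intr_Fp_eq0 // (negbTE p'r) andbF.
have [p2_s | p2's] := boolP (p%:Z ^+ 2 %| homsum a r (s ^+ b))%Z; last by exists s.
pose t := s + 4 * p%:Z; exists t; split.
- by rewrite /t addrC mulrC modzMDl.
- by apply: hom_mod; rewrite /t addrC modzMDl.
apply/negP=> p2_t.
have : (p%:Z ^+ 2 %| s ^+ (b * a) - t ^+ (b * a))%Z.
  have -> : s ^+ (b * a) - t ^+ (b * a) = (r - t ^+ b) * homsum a r (t ^+ b) -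
      (r - s ^+ b) * homsum a r (s ^+ b) by rewrite !mul_homsum !exprM; ring.
  by rewrite rpredB ?dvdz_mull.
have Dst : s - t = - (4 * p%:Z) by rewrite /t; ring.
rewrite -mul_homsum Dst mulNr rpredN -mulrA mulrCA expr2 dvdz_mul2l ?p0 //.
rewrite Gauss_dvdzr; last first.
  by rewrite coprimez_sym.
apply/negP; apply: homsum_diag_ndvd => //; last by rewrite Dst rpredN dvdz_mull.
by rewrite Euclid_dvdM // negb_or p'b.
Qed.

Lemma sum2sq_6mod8 (a b p : nat) (n z : int) :
  SchinzelH -> prime a -> prime b -> a = 1 %[mod 4] -> b = 1 %[mod 4] ->
  (forall y : int, n <> y ^+ b) -> (n %% 8)%Z = 6 ->
  prime p -> p = 3 %[mod 4] -> (b %| vp p n)%N -> odd (vp p n) ->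
  (p %| homsum a (rp p n) (z ^+ b))%Z ->
  exists z : int, sum2sq (n ^+ a - z ^+ (a * b)).
Proof.
move=> H a_pr b_pr a1 b1 n_npow n6 p_pr p3 b_vp vp_odd p_z.
have [a_odd b_odd] := (prime_1mod4_odd a1, prime_1mod4_odd b1).
have [a_gt4 b_gt4] := (prime_1mod4_gt4 a_pr a1, prime_1mod4_gt4 b_pr b1).
have [a_gt0 b_gt0] := (prime_gt0 a_pr, prime_gt0 b_pr).
have [p'a p'b] := (prime_3mod4_ndvd p_pr a_pr p3 a1, prime_3mod4_ndvd p_pr b_pr p3 b1).
have p_odd : odd p by clear -p3; lia.
have n0 : n != 0 by apply: contra_eqN n6 => /eqP ->.
have [Dn p'r] := vp_rp p_pr n0.
set al := vp p n in b_vp vp_odd Dn; set r := rp p n in p'r Dn p_z.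
have [s [s1 p_s p2's]] := exists_simple_homsum p_pr p_odd a_gt0 p'a b_gt0 p'b p'r p_z.
have /dvdnP[be Dal] := b_vp; pose P := p%:Z.
have P3 : (P %% 4 = 3)%Z by rewrite /P modz_nat p3.
have P_odd : (P %% 2 = 1)%Z by clear -P3; lia.
have Pexp (e : nat) : odd e -> (P ^+ e %% 4 = 3)%Z by move=> e_odd; rewrite exp_odd_mod4.
have P0 : P != 0 by rewrite -lt0n prime_gt0.
have be_odd : odd be by move: vp_odd; rewrite Dal oddM => /andP[].
(* Since [-t0^b = p^al s^b], the power [p^al] comes out of the first factor and [p^(al (a-1))] out
   of the second, which has exactly one more factor [p] by the choice of [s]. The sign makes
   [t0 = 1 mod 4]. *)
pose t0 := - (P ^+ be * s).
have Dt0 : - t0 ^+ b = P ^+ al * s ^+ b.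
  by rewrite /t0 exprNn -signr_odd b_odd mulN1r opprK exprMn -exprM Dal.
have t01 : (t0 %% 4 = 1)%Z.
  have : ((P ^+ be * s) %% 4 = 3)%Z by rewrite -modzMm Pexp // s1.
  by rewrite /t0; move: (P ^+ be * s) => u; clear; lia.
have t0_odd : (t0 %% 2 = 1)%Z by clear -t01; lia.
have t0b : (t0 ^+ b %% 4 = 1)%Z by rewrite exp_odd_mod4.
have t0ab : (t0 ^+ (a * b) %% 4 = 1)%Z by rewrite exp_odd_mod4 // oddM a_odd.
have na : (n ^+ a %% 4 = 0)%Z.
  have [q Dq] : exists q, n = 2 * q by exists (n %/ 2)%Z; clear -n6; lia.
  have a_ge2 : (2 <= a)%N by clear -a_gt4; lia.
  by rewrite Dq exprMn -(subnKC a_ge2) exprD -mulrA modzMr.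
have mod4_3 (u v : int) : (u %% 4 = 3)%Z -> ((u * v) %% 4 = 3)%Z -> (v = 1 %[mod 4])%Z.
  by move=> u3; rewrite -modzMml u3; clear; lia.
pose w1 := r - s ^+ b.
have Dw1 : n + t0 ^+ b = P ^+ al * w1.
  by rewrite -[t0 ^+ b]opprK Dt0 {1}Dn mulrBr.
have f1_3 : ((n + t0 ^+ b) %% 4 = 3)%Z by clear -n6 t0b; lia.
have w11 : (w1 = 1 %[mod 4])%Z by apply: mod4_3 (Pexp _ vp_odd) _; rewrite -Dw1.
have /dvdzP[w2 Dw2] := p_s.
have {}Dw2 : homsum a n (- t0 ^+ b) = P ^+ (al * (a - 1)).+1 * w2.
  by rewrite Dt0 {1}Dn homsumZ Dw2 -exprM exprSr; ring.
have e2_odd : odd (al * (a - 1)).+1.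
  by rewrite /= oddM; clear -a_odd a_gt0; lia.
(* The product of the two factors is [n^a + t0^(a b)], which is 1 modulo 4, and the first factor is
   [3 mod 4]. *)
have f2_3 : (homsum a n (- t0 ^+ b) %% 4 = 3)%Z.
  have : ((n + t0 ^+ b) * homsum a n (- t0 ^+ b) %% 4 = 1)%Z.
    rewrite -[X in n + X]opprK mul_homsum exprNn -signr_odd a_odd mulN1r opprK.
    rewrite -exprM mulnC; move: (n ^+ a) (_ ^+ (a * b)) na t0ab; clear; lia.
  by rewrite -modzMml f1_3; move: (homsum _ _ _) => u; clear; lia.
have w21 : (w2 = 1 %[mod 4])%Z by apply: mod4_3 (Pexp _ e2_odd) _; rewrite -Dw2.
have coK (w : int) : (w = 1 %[mod 4])%Z -> ~~ (p %| w)%Z -> coprimez w (2 * p)%N.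
  move=> w1' p'w; rewrite coprimezE absz_nat coprimeMr coprimen2 coprime_sym.
  by rewrite prime_coprime // -[p in (p %| _)%N]absz_nat -dvdzE p'w andbT; clear -w1'; lia.
have Pe e : (p ^ e)%N%:Z = P ^+ e by rewrite -natz natrX natz.
have p_K e f : (e <= f)%N -> (p ^ e %| (2 * p) ^ f)%N.
  by move=> le_ef; rewrite expnMn dvdn_mull // dvdn_exp2l.
apply: (@sum2sq_factored a b n t0 w1 w2 (p ^ al) (p ^ (al * (a - 1)).+1) (2 * p)
  (al + (al * (a - 1)).+1)); rewrite ?Pe //.
- by rewrite dvdn_mulr.
- by rewrite muln_gt0 /= prime_gt0.
(* The total exponent [al a + 1] is even, so the product of the two powers of [p] is a square. *)
- rewrite -exprD (_ : (_ + _)%N = ((al * a).+1./2 * 2)%N) ?exprM; first exact: sum2sq_sqr.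
  have : odd (al * a) by rewrite oddM vp_odd.
  have : (al * a = al + al * (a - 1))%N by rewrite -mulnS; congr (_ * _)%N; clear -a_gt0; lia.
  by move: (al * a)%N (al * (a - 1))%N; clear; lia.
- by rewrite p_K ?leq_addr.
- by rewrite p_K ?leq_addl.
(* If [p] divided [w1 = r - s^b], the homogeneous sum of [r] and [s^b] would be a unit modulo
   [p]. *)
- apply: coK => //; apply/negP=> p_w1.
  by case/negP: (homsum_diag_ndvd p_pr p'a p_w1 p'r).
- apply: coK => //; apply: contra p2's => /dvdzP[q Dq].
  have := homsumZ a (P ^+ al) r (s ^+ b).
  rewrite -Dn -Dt0 Dw2 Dq -exprM exprSr => /eqP.
  rewrite -mulrA (inj_eq (mulfI _)) ?expf_neq0 //.
  by move/eqP <-; apply/dvdzP; exists q; rewrite /P; ring.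
Qed.

Lemma sum2sq_perfect_power (a b : nat) (m n : int) :
  SchinzelH -> prime a -> prime b -> a = 1 %[mod 4] -> b = 1 %[mod 4] ->
  m = n ^+ a -> ~ exceptional a b m -> exists z : int, sum2sq (m - z ^+ (a * b)).
Proof.
move=> H a_pr b_pr a1 b1 Dm not_exc.
have [[l Dl] | n_npow] := classic (exists l : int, n = l ^+ b).
  (* Here [m = l^(a b)], and [z = l] leaves 0. *)
  exists l; rewrite Dm Dl -exprM mulnC subrr; exists 0, 0 => //.
have {}n_npow y : n <> y ^+ b by move=> Dn; apply: n_npow; exists y.
have [n6 | n6] := eqVneq (n %% 8)%Z 6; last first.
  by rewrite Dm; apply: sum2sq_not_6mod8 => //; apply/eqP.
apply: NNPP => no_sol; apply: not_exc; exists n; split=> // p p_pr p3 _.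
have [b_vp | ?] := boolP (b %| vp p n)%N; last by constructor 1.
have [vp2 | vp_odd] := boolP (2 %| vp p n)%N; first by constructor 2.
constructor 3 => -[z [_ p_z]]; apply: no_sol; rewrite Dm.
apply: (@sum2sq_6mod8 a b p n z%:Z) => //; first by rewrite dvdn2 negbK in vp_odd.
congr (is_true (_ %| _)%Z): p_z.
by apply: eq_bigr => i _; rewrite mulnC exprM.
Qed.

Theorem theorem5p11 (a b k : nat) (m : int)
  (a_prime : prime a) (b_prime : prime b)
  (a_mod4 : a = 1 %[mod 4]) (b_mod4 : b = 1 %[mod 4])
  (k_def : k = (a * b)%N) (m_neq0 : m <> 0) :
  ((exists x y z : int, x ^+ 2 + y ^+ 2 + z ^+ k = m) ->
     ~ exceptional a b m /\ ~ exceptional b a m)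
  /\
  (SchinzelH ->
     ~ exceptional a b m /\ ~ exceptional b a m ->
     exists x y z : int, x ^+ 2 + y ^+ 2 + z ^+ k = m).
Proof.
rewrite {}k_def; split=> [[x [y [z Dm]]] | H [not_ab not_ba]].
  have m_sum : sum2sq (m - z ^+ (a * b)) by exists x, y; rewrite -Dm addrK.
  split; first exact: not_exceptional m_sum.
  by apply: not_exceptional (z) _ _ _ _ _ => //; rewrite mulnC.
suff [z [x [y Dxy]]] : exists z : int, sum2sq (m - z ^+ (a * b)).
  by exists x, y, z; rewrite -Dxy subrK.
have [[n Dm] | m_npow_a] := classic (exists n : int, m = n ^+ a).
  exact: sum2sq_perfect_power Dm not_ab.
have [[n Dm] | m_npow_b] := classic (exists n : int, m = n ^+ b).
  by rewrite mulnC; apply: sum2sq_perfect_power Dm not_ba.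
have ab_odd : odd (a * b) by rewrite oddM !prime_1mod4_odd.
apply: sum2sq_irreducible => //; apply: irreducible_Xn_addC => // [|p p_pr].
  by rewrite (ltn_trans (prime_gt1 a_prime)) // ltn_Pmulr ?prime_gt0 ?prime_gt1.
rewrite Euclid_dvdM // !dvdn_prime2 // => /orP[] /eqP -> y Dm.
  by apply: m_npow_a; exists y.
by apply: m_npow_b; exists y.
Qed.
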